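(* Let $2\le r<s\le k$ be fixed integers, and let $\ell=\ell_k(r,s)$ be the smallest integer $\ell\ge0$ such that $$k-\ell-r-\frac{k-\ell}{\binom ks-\binom{\ell}{s}}\sum_{j=1}^r\binom{\ell}{s-j}\left[\binom{k-\ell}{j}-\binom rj\right]\le0 .$$ Then there is a strategy $\mathcal S$ such that for every $t=t(n)\gg n^{\,r-\frac{k-\ell}{\binom ks-\binom{\ell}s}}$, a.a.s. $G^{(r,s)}_t$ contains a copy of the complete $s$-uniform hypergraph $K_k^{(s)}$. Thus $\tau^{(r)}(K_k^{(s)})\le n^{\,r-\frac{k-\ell}{\binom ks-\binom{\ell}s}}$.
   Context: Semi-random hypergraph process: fix integers $1\le r<s$ and $n\ge s$. Start with the empty $s$-uniform multi-hypergraph $G_0^{(r,s)}$ on $[n]$. In each step $t\ge1$, a set $U_t$ of $r$ vertices is chosen uniformly at random among all $r$-subsets of $[n]$, independently of all previous choices; the player chooses an $(s-r)$-set $V_t\subseteq[n]\setminus U_t$, and the edge $U_t\cup V_t$ is added to form $G^{(r,s)}_t$ (parallel edges allowed). A strategy is, for each $n$, a sequence of functions determining $V_t$ from $(U_1,V_1,\dots,U_{t-1},V_{t-1},U_t)$. A.a.s. means with probability $\to1$ as $n\to\infty$; $a_n\gg b_n$ means $b_n=o(a_n)$. $K_k^{(s)}$ is the $s$-uniform hypergraph on $k$ vertices having all $\binom ks$ $s$-subsets as edges. Binomial coefficients $\binom{a}{b}$ with $0\le a<b$ are $0$. *)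

(* Defs.v *)
From Stdlib Require Import Reals.
From mathcomp Require Import all_boot.

Set Implicit Arguments.
Unset Strict Implicit.
Unset Printing Implicit Defensive.

(* A strategy: for each n, a function from the history
   ((U_1,V_1),...,(U_{t-1},V_{t-1})) (chronological) and U_t to V_t. *)
Definition strategy :=
  forall n : nat, seq ({set 'I_n} * {set 'I_n}) -> {set 'I_n} -> {set 'I_n}.

Definition valid_strategy (r s : nat) (S : strategy) : Prop :=
  forall n : nat, s <= n ->
  forall (hist : seq ({set 'I_n} * {set 'I_n})) (U : {set 'I_n}),
    #|U| = r -> #|S n hist U| = s - r /\ [disjoint U & S n hist U].

Fixpoint play_aux (n : nat) (f : seq ({set 'I_n} * {set 'I_n}) -> {set 'I_n} -> {set 'I_n})
  (hist : seq ({set 'I_n} * {set 'I_n})) (us : seq {set 'I_n}) :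
  seq ({set 'I_n} * {set 'I_n}) :=
  match us with
  | [::] => hist
  | u :: us' => play_aux f (rcons hist (u, f hist u)) us'
  end.

Definition edges_of (S : strategy) (n : nat) (us : seq {set 'I_n}) : seq {set 'I_n} :=
  map (fun p => p.1 :|: p.2) (play_aux (S n) [::] us).

Definition contains_clique (n k s : nat) (E : seq {set 'I_n}) : bool :=
  [exists K : {set 'I_n}, (#|K| == k) &&
     [forall e : {set 'I_n}, ((e \subset K) && (#|e| == s)) ==> (e \in E)]].

(* Probability that G_t^{(r,s)} (on [n], played with S) contains K_k^(s):
   U_1..U_t are i.i.d. uniform r-subsets, i.e. the t-tuple of U's is uniform
   over all t-tuples of r-subsets of 'I_n. *)
Definition prob_clique (r s k : nat) (S : strategy) (n t : nat) : R :=
  Rdiv (INR #|[set w : t.-tuple {set 'I_n} |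
            all (fun U : {set 'I_n} => #|U| == r) (tval w) && contains_clique k s (edges_of S (tval w))]|)
   (INR #|[set w : t.-tuple {set 'I_n} | all (fun U : {set 'I_n} => #|U| == r) (tval w)]|).

Definition ell_cond (k r s l : nat) : Prop :=
  Rle (Rminus (Rminus (Rminus (INR k) (INR l)) (INR r))
         (Rmult (Rdiv (Rminus (INR k) (INR l)) (Rminus (INR 'C(k, s)) (INR 'C(l, s))))
                (sum_f 1 r (fun j => Rmult (INR 'C(l, s - j))
                                           (Rminus (INR 'C(k - l, j)) (INR 'C(r, j)))))))
      R0.

Definition expo (k r s l : nat) : R :=
  Rminus (INR r) (Rdiv (Rminus (INR k) (INR l)) (Rminus (INR 'C(k, s)) (INR 'C(l, s)))).

Definition much_larger (a b : nat -> R) : Prop :=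
  forall eps : R, Rlt R0 eps ->
    exists N : nat, forall n : nat, N <= n -> Rle (Rabs (b n)) (Rmult eps (Rabs (a n))).

(* Main.v *)
Require Import Defs.
From Stdlib Require Import Reals.
From mathcomp Require Import all_boot.
From mathcomp Require Import all_order all_algebra.
From mathcomp Require Import zify ring lra.
From mathcomp Require Import Rstruct.
From Stdlib Require Import IndefiniteDescription.

(** The player plays independent blocks of O(n^expo) steps, each of which
    produces a K_k with probability bounded below by a constant; since t is
    much larger than n^expo, the number of blocks tends to infinity and so the
    probability that all of them fail tends to 0.

    A block first builds a clique on an l-set L recursively (K_l is cheaper
    than K_k, by convexity of binomial coefficients; nothing is needed when
    l < s), and then extends L by h = k - l vertices, one in each of h disjoint
    parts of q vertices. The e = C(k,s) - C(l,s) missing edges are treated one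
    type after the other, in a phase of m steps each, so that a given r-set is
    hit in a given phase with probability about p = m / C(n,r), and
    q^h p^e is of order 1. An edge with j <= r vertices outside L is built when
    the random r-set contains these j vertices and r - j prescribed vertices of
    L. After these phases, call a copy (choice of one vertex per part) present
    if all its edges of that kind are there, and isolated if it shares at least
    r vertices with no other present copy. The condition on l says precisely
    that a present copy has O(1) expected present copies sharing r given
    vertices with it, so a positive proportion of present copies is isolated
    when m is small enough. An r-set lies in at most one isolated copy: in the
    remaining phases (j > r) the player can answer with the edge of that copy,
    without ever having to choose between copies. A second moment computation
    then shows that some isolated copy is completed with probability bounded
    below. *)

Set Implicit Arguments.
Unset Strict Implicit.
Unset Printing Implicit Defensive.
Import Order.TTheory GRing.Theory Num.Theory.

(** * Expectation over uniform sequences *)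

Section Expectation.
Local Open Scope ring_scope.
Variables (R : realFieldType) (T : finType) (Om : {set T}).

(** Recursion on lists, rather than a sum over tuples, makes conditioning on the first draws a
    matter of unfolding. *)
Fixpoint Ex (m : nat) (f : seq T -> R) : R :=
  if m is m'.+1 then (#|Om|%:R)^-1 * \sum_(u in Om) Ex m' (fun w => f (u :: w))
  else f [::].

Lemma Ex_le m f g :
  (forall w, size w = m -> all (mem Om) w -> f w <= g w) -> Ex m f <= Ex m g.
Proof.
elim: m f g => [|m IH] f g H /=; first exact: H.
apply: ler_wpM2l; first by rewrite invr_ge0 ler0n.
apply: ler_sum => u uO; apply: IH => w sw aw; apply: H => /=; first by rewrite sw.
by apply/andP.
Qed.

Lemma Ex_eq m f g :
  (forall w, size w = m -> all (mem Om) w -> f w = g w) -> Ex m f = Ex m g.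
Proof.
by move=> H; apply/eqP; rewrite eq_le; apply/andP; split; apply: Ex_le => w sw aw;
  rewrite H.
Qed.

Lemma Ex_sum (I : Type) (s : seq I) (P : pred I) m (f : I -> seq T -> R) :
  Ex m (fun w => \sum_(i <- s | P i) f i w) = \sum_(i <- s | P i) Ex m (f i).
Proof.
elim: m f => [//|m IH] f /=.
under eq_bigr do rewrite IH.
by rewrite exchange_big /= mulr_sumr.
Qed.

Lemma ExZ m a f : Ex m (fun w => a * f w) = a * Ex m f.
Proof.
elim: m f => [//|m IH] f /=.
under eq_bigr do rewrite IH.
by rewrite -mulr_sumr mulrCA.
Qed.

Lemma ExD m f g : Ex m (fun w => f w + g w) = Ex m f + Ex m g.
Proof.
elim: m f g => [//|m IH] f g /=.
under eq_bigr do rewrite IH.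
by rewrite big_split /= mulrDr.
Qed.

Lemma ExB m f g : Ex m (fun w => f w - g w) = Ex m f - Ex m g.
Proof.
rewrite -[- Ex m g]mulN1r -ExZ -ExD; apply: Ex_eq => w _ _; by rewrite mulN1r.
Qed.

Lemma Ex_cat a b f : Ex (a + b) f = Ex a (fun x => Ex b (fun y => f (x ++ y))).
Proof.
elim: a f => [//|a IH] f /=.
by congr (_ * _); apply: eq_bigr => u _; rewrite IH.
Qed.

Hypothesis Om0 : (0 < #|Om|)%N.

Lemma Ex_cst m a : Ex m (fun=> a) = a.
Proof.
elim: m => [//|m IH] /=; rewrite IH sumr_const -[a *+ _]mulr_natl mulKf //.
by rewrite pnatr_eq0 -lt0n.
Qed.

(** Links the recursive expectation to the counting of tuples by which the probability of a clique
    is defined. *)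
Lemma card_Ex m (P : pred (seq T)) :
  #|[set w : m.-tuple T | all (mem Om) w && P w]|%:R
  = #|Om|%:R ^+ m * Ex m (fun w => (P w)%:R).
Proof.
transitivity (\sum_(w : m.-tuple T) (all (mem Om) w && P w)%:R : R).
  rewrite -sum1_card natr_sum big_mkcond /=; apply: eq_bigr => w _.
  by rewrite inE; case: (_ && _).
elim: m P => [|m IH] P.
  rewrite expr0 mul1r (bigD1 [tuple]) //= big1 ?addr0 // => w.
  by rewrite tuple0 => /eqP.
rewrite (reindex (fun p : T * m.-tuple T => [tuple of p.1 :: p.2])) /=; last first.
  exists (fun w : m.+1.-tuple T => (thead w, [tuple of behead w])).
    by case=> x w _ /=; congr pair; apply: val_inj.
  by move=> w _ /=; rewrite -tuple_eta.
rewrite -(pair_bigA _ (fun x (w : m.-tuple T) => ((x \in Om) && all (mem Om) w && P (x :: w))%:R)) /=.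
rewrite exprS [_ * _ * _]mulrACA mulfV ?mul1r ?pnatr_eq0 -?lt0n // mulr_sumr.
rewrite [RHS]big_mkcond; apply: eq_bigr => x _; case: ifP => xO; last by rewrite big1.
by rewrite -IH.
Qed.

Lemma Ex_take a b f : Ex (a + b) (fun w => f (take a w)) = Ex a f.
Proof.
rewrite Ex_cat; apply: Ex_eq => x sx _.
by rewrite -[RHS](Ex_cst b); apply: Ex_eq => y _ _; rewrite take_size_cat.
Qed.

Definition chunk (m i : nat) (w : seq T) := take m (drop (i * m) w).

(** Independence of disjoint blocks of draws, used both for the phases of a stage and for repeated
    attempts. *)
Lemma Ex_chunks c m (G : nat -> seq T -> R) :
  Ex (c * m) (fun w => \prod_(i < c) G i (chunk m i w)) = \prod_(i < c) Ex m (G i).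
Proof.
elim: c G => [|c IH] G; first by rewrite /= !big_ord0.
rewrite mulSn Ex_cat big_ord_recl [X in _ = _ * X](_ : _ = \prod_(i < c) Ex m (G i.+1)) //.
rewrite -(IH (fun i => G i.+1)) mulrC -ExZ; apply: Ex_eq => x sx _.
rewrite [RHS]mulrC -ExZ; apply: Ex_eq => y _ _; rewrite big_ord_recl /chunk.
rewrite mul0n drop0 take_size_cat //; congr (_ * _); apply: eq_bigr => i _.
by rewrite /= /bump /= add1n mulSn addnC -drop_drop drop_size_cat.
Qed.

(** Expand the nonnegative expectation of [(X - t * (X != 0)) ^+ 2]; the choice [t = b / a] gives
    the bound without a separate Cauchy-Schwarz inequality. *)
Lemma Ex_second_moment m (X : seq T -> R) (a b : R) :
  0 < a -> 0 < b -> a <= Ex m X -> Ex m (fun w => X w ^+ 2) <= b ->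
  a ^+ 2 / b <= Ex m (fun w => (X w != 0)%:R).
Proof.
move=> a0 b0 aX Xb; set Y := Ex m (fun w => _); pose t := b / a.
have t0 : 0 < t by rewrite divr_gt0.
have : 0 <= Ex m (fun w => (X w - t * (X w != 0)%:R) ^+ 2).
  by rewrite -[X in X <= _](Ex_cst m); apply: Ex_le => w _ _; exact: sqr_ge0.
rewrite (Ex_eq (g := fun w => X w ^+ 2 + (- (2 * t) * X w + t ^+ 2 * (X w != 0)%:R))).
  rewrite !ExD !ExZ => H.
  have tE : t * a = b by rewrite /t divfK // gt_eqF.
  have : t * a <= t * Ex m X by rewrite ler_pM2l.
  rewrite tE => H1.
  have : b <= t ^+ 2 * Y.
    by move: H Xb H1; rewrite -/Y; set e2 := Ex _ _; set e1 := Ex _ _ => ? ? ?; lra.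
  rewrite -(ler_pM2l (exprn_gt0 2 a0)) mulrA -exprMn [a * t]mulrC tE => H2.
  by rewrite ler_pdivrMr // -(ler_pM2r b0) (le_trans H2) // mulrC expr2 mulrA.
by move=> w _ _; case: eqP => [->|_] /=; ring.
Qed.

Lemma Ex_miss m u : u \in Om ->
  Ex m (fun w => (u \notin w)%:R) = (1 - (#|Om|%:R)^-1) ^+ m.
Proof.
move=> uO; have N0 : #|Om|%:R != 0 :> R by rewrite pnatr_eq0 -lt0n.
elim: m => [//|m IH] /=; rewrite exprS.
rewrite (bigD1 u) //= [X in X + _](_ : _ = 0); last first.
  by rewrite -[RHS](Ex_cst m); apply: Ex_eq => w _ _; rewrite inE eqxx.
rewrite add0r (eq_bigr (fun=> (1 - (#|Om|%:R)^-1) ^+ m)); last first.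
  move=> v /andP[_ vu]; rewrite -IH; apply: Ex_eq => w _ _.
  by rewrite inE negb_or eq_sym vu.
rewrite sumr_const -[_ ^+ m *+ _]mulr_natl mulrA; congr (_ * _).
rewrite (cardD1 u) uO in N0 *.
rewrite [#|[pred _ in _ | _]|](_ : _ = #|[predD1 Om & u]|); last first.
  by apply: eq_card => v; rewrite !inE andbC.
move: N0; set k := #|_|; rewrite natrD /= => N0.
by field.
Qed.

(** With [x] the inverse of [#|Om|], a miss has probability [(1 - x) ^+ m], and induction on [m]
    gives [(1 - x) ^+ m * (1 + m x) <= 1]. *)
Lemma Ex_hit_ge m u : u \in Om ->
  (m%:R / #|Om|%:R) / (1 + m%:R / #|Om|%:R) <= Ex m (fun w => (u \in w)%:R).
Proof.
move=> uO; have N0 : 0 < #|Om|%:R :> R by rewrite ltr0n.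
set x := (#|Om|%:R)^-1 : R.
have x0 : 0 < x by rewrite invr_gt0.
have x1 : x <= 1 by rewrite invf_le1 // ler1n.
have p0 : 0 < 1 + m%:R * x by rewrite ltr_pwDl // mulr_ge0 // ltW.
have -> : Ex m (fun w => (u \in w)%:R) = 1 - (1 - x) ^+ m.
  rewrite -(Ex_miss m uO) -[X in X - _](Ex_cst m) -ExB.
  by apply: Ex_eq => w _ _; case: (u \in w); rewrite ?subr0 ?subrr.
have H : (1 - x) ^+ m * (1 + m%:R * x) <= 1.
  elim: m {p0} => [|m IH]; first by rewrite expr0 mul0r addr0 mulr1.
  apply: le_trans IH; rewrite exprSr -mulrA ler_wpM2l ?exprn_ge0 ?subr_ge0 //.
  rewrite -natr1; have : 0 <= m%:R :> R by []. nra.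
by rewrite ler_pdivrMr //; nra.
Qed.

Lemma Ex_hit_le m u : u \in Om ->
  Ex m (fun w => (u \in w)%:R) <= m%:R / #|Om|%:R.
Proof.
move=> uO; have N0 : 0 < #|Om|%:R :> R by rewrite ltr0n.
elim: m => [|m IH] /=; first by rewrite mul0r.
rewrite mulrC ler_pM2r ?invr_gt0 // (bigD1 u) //=.
rewrite (Ex_eq (g := fun=> 1)) ?Ex_cst; last by move=> w _ _; rewrite inE eqxx.
rewrite -natr1 addrC lerD2r.
apply: le_trans (_ : \sum_(v in Om) (m%:R / #|Om|%:R) <= _).
  rewrite [leRHS](bigD1 u) //= ler_wpDl ?divr_ge0 //.
  apply: ler_sum => v /andP[_ vu]; apply: le_trans IH; apply: Ex_le => w _ _.
  by rewrite inE eq_sym (negPf vu).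
by rewrite sumr_const -[(_ / _) *+ _]mulr_natr divfK // gt_eqF.
Qed.

(** Split on whether the first draw is [u], [v] or neither. The induction closes because
    [m^2 + 2m <= (m+1)^2]. *)
Lemma Ex_hit2_le m u v : u \in Om -> v \in Om -> u != v ->
  Ex m (fun w => ((u \in w) && (v \in w))%:R) <= (m%:R / #|Om|%:R) ^+ 2.
Proof.
move=> uO vO uv; have N0 : 0 < #|Om|%:R :> R by rewrite ltr0n.
have vu : v != u by rewrite eq_sym.
elim: m => [|m IH] /=; first by rewrite mul0r expr0n.
rewrite (bigD1 u) //= (bigD1 v) /=; last by rewrite vO.
set x := (#|Om|%:R)^-1 in IH *.
have x0 : 0 < x by rewrite invr_gt0.
have A1 : Ex m (fun w => ((u \in u :: w) && (v \in u :: w))%:R) <= m%:R * x.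
  apply: le_trans (Ex_hit_le m vO); apply: Ex_le => w _ _.
  by rewrite !inE eqxx (negPf vu).
have A2 : Ex m (fun w => ((u \in v :: w) && (v \in v :: w))%:R) <= m%:R * x.
  apply: le_trans (Ex_hit_le m uO); apply: Ex_le => w _ _.
  by rewrite !inE eqxx (negPf uv) andbT.
have A3 : \sum_(i in Om | (i != u) && (i != v)) Ex m (fun w => ((u \in i :: w) && (v \in i :: w))%:R)
   <= #|Om|%:R * (m%:R * x) ^+ 2.
  apply: le_trans (_ : \sum_(i in Om) (m%:R * x) ^+ 2 <= _).
    rewrite [leRHS](bigID (fun i => (i != u) && (i != v))) /=.
    rewrite ler_wpDr ?sumr_ge0 // => [i _|]; first exact: sqr_ge0.
    apply: ler_sum => i /and3P[_ iu iv]; apply: le_trans IH; apply: Ex_le => w _ _.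
    by rewrite !inE ![_ == i]eq_sym (negPf iu) (negPf iv).
  by rewrite sumr_const -[_ ^+ 2 *+ _]mulr_natl.
have E : x * #|Om|%:R = 1 by rewrite mulVf // gt_eqF.
rewrite (eq_bigl (fun i => (i \in Om) && ((i != u) && (i != v)))); last by move=> i; rewrite andbA.
apply: le_trans (_ : x * (m%:R * x + (m%:R * x + #|Om|%:R * (m%:R * x) ^+ 2)) <= _).
  by rewrite ler_wpM2l ?(ltW x0) // !lerD.
rewrite !mulrDr [x * (_ * _ ^+ 2)]mulrA E mul1r -natr1.
nra.
Qed.

End Expectation.

(** * Convexity of edge counts *)

Section Convexity.
Local Open Scope nat_scope.

(** Both averages are compared with the value [d b]. All the convexity inequalities below reduce to
    this. *)
Lemma leq_avg_nondecreasing (d : nat -> nat) a b c :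
  {homo d : x y / x <= y} -> a <= b -> b <= c ->
  (c - b) * \sum_(a <= u < b) d u <= (b - a) * \sum_(b <= u < c) d u.
Proof.
move=> dm ab bc.
have H1 : \sum_(a <= u < b) d u <= (b - a) * d b.
  rewrite -(sum_nat_const_nat a b) big_seq [leqRHS]big_seq.
  by apply: leq_sum => u; rewrite mem_index_iota => /andP[_ /ltnW/dm].
have H2 : (c - b) * d b <= \sum_(b <= u < c) d u.
  rewrite -(sum_nat_const_nat b c) big_seq [leqRHS]big_seq.
  by apply: leq_sum => u; rewrite mem_index_iota => /andP[/dm].
apply: leq_trans (leq_mul (leqnn _) H1) _.
by rewrite mulnCA leq_mul2l H2 orbT.
Qed.

Lemma bin_sum_col i j : 'C(i, j.+1) = \sum_(0 <= u < i) 'C(u, j).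
Proof.
elim: i => [|i IH]; first by rewrite big_geq.
by rewrite big_nat_recr //= -IH binS.
Qed.

Lemma leq_bin_mid h j : 0 < j -> j < h -> h <= 'C(h, j).
Proof.
case: j => // j _; elim: h => // h IH; rewrite ltnS leq_eqVlt => /orP[/eqP <-|jh].
  by rewrite binSn.
rewrite binS; have := IH jh; have : 0 < 'C(h, j) by rewrite bin_gt0; lia.
lia.
Qed.

(* Number of s-sets having between 1 and c vertices in a set of size i and the
   other ones in a disjoint set of size l. *)
Definition nedges s l c i := \sum_(1 <= j < c.+1) 'C(l, s - j) * 'C(i, j).

(** The discrete derivative of [nedges] in its last argument. Being nondecreasing, it makes the edge
    count convex. *)
Definition dedges s l c u := \sum_(1 <= j < c.+1) 'C(l, s - j) * 'C(u, j.-1).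

Lemma dedges_homo s l c : {homo dedges s l c : x y / x <= y}.
Proof.
move=> x y xy; rewrite /dedges; apply: leq_sum => j _; exact: leq_mul (leqnn _) (leq_bin2l _ xy).
Qed.

Lemma nedges_sum s l c i : nedges s l c i = \sum_(0 <= u < i) dedges s l c u.
Proof.
rewrite /nedges /dedges exchange_big /= big_seq [RHS]big_seq.
apply: eq_bigr => -[|j]; rewrite mem_index_iota // => _.
by rewrite bin_sum_col big_distrr.
Qed.

Lemma nedges_sum_from s l c i h : i <= h ->
  nedges s l c h = nedges s l c i + \sum_(i <= u < h) dedges s l c u.
Proof. by move=> ih; rewrite !nedges_sum (big_cat_nat _ ih). Qed.

Lemma leq_nedges s l c i h : i <= h -> nedges s l c i <= nedges s l c h.
Proof. by move=> ih; rewrite (nedges_sum_from _ _ _ ih) leq_addr. Qed.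

Lemma leq_nedgesc s l c c' i : c <= c' -> nedges s l c i <= nedges s l c' i.
Proof.
by move=> cc; rewrite /nedges [leqRHS](@big_cat_nat _ _ _ c.+1) ?leq_addr.
Qed.

(** Convexity together with truncation at [r <= s]. In the second moment it controls pairs of copies
    sharing fewer than [r] vertices. *)
Lemma nedges_density s l r i h : r <= s -> i <= h ->
  h * nedges s l r i <= i * nedges s l s h.
Proof.
move=> rs ih; apply: leq_trans (leq_mul (leqnn h) (leq_nedgesc s l i rs)) _.
have := leq_avg_nondecreasing (@dedges_homo s l s) (leq0n i) ih.
rewrite (nedges_sum_from _ _ _ ih) -nedges_sum subn0 => H.
by rewrite -{1}(subnK ih) mulnDl mulnDr addnC leq_add2l.
Qed.

(** The hypothesis is the condition on [l] with denominators cleared. It passes from [r] to every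
    larger [i] because the average increment over [[i, h)] is at least that over [[r, h)]. In the
    first moment it controls copies sharing [i] vertices. *)
Lemma nedges_extension s l r i h : r <= i -> i <= h ->
  (h - r) * nedges s l s h <= h * (nedges s l r h - nedges s l r r) ->
  (h - i) * nedges s l s h <= h * (nedges s l r h - nedges s l r i).
Proof.
move=> ri ih H; have rh := leq_trans ri ih.
have [->|hi] := eqVneq i h; first by rewrite subnn.
have hr : 0 < h - r by lia.
rewrite -(leq_pmul2l hr) mulnCA.
apply: leq_trans (leq_mul (leqnn _) H) _.
rewrite mulnCA [leqRHS]mulnCA leq_mul2l.
have E a : a <= h -> nedges s l r h - nedges s l r a = \sum_(a <= u < h) dedges s l r u.
  by move=> ah; rewrite (nedges_sum_from s l r ah) addKn.
rewrite !E //.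
have := leq_avg_nondecreasing (@dedges_homo s l r) ri ih.
rewrite (big_cat_nat ri ih) /= mulnDr.
set A := \sum_(r <= u < i) _; set B := \sum_(i <= u < h) _.
have -> : (h - r) * B = (i - r) * B + (h - i) * B by rewrite -mulnDl; congr (_ * _); lia.
by rewrite leq_add2r => ->; rewrite orbT.
Qed.

(** A nonzero summand has [1 <= j <= r < h], so its factor ['C(h, j)] is already at least [h]. *)
Lemma nedges_gt0_geq s l r h : r < h -> 0 < nedges s l r h -> h <= nedges s l r h.
Proof.
move=> rh H; apply: contraTT H; rewrite -!ltnNge /nedges ltnS leqn0 => H.
rewrite big_seq big1 // => j; rewrite mem_index_iota => /andP[j0 jr].
apply/eqP; apply: contraTT H => nz; rewrite -leqNgt.
have jI : j \in index_iota 1 r.+1 by rewrite mem_index_iota j0.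
rewrite (bigD1_seq j) ?iota_uniq //=; apply: leq_trans (leq_addr _ _).
apply: leq_trans (leq_bin_mid j0 _) _; first by apply: leq_trans rh.
by apply: leq_pmull; move: nz; rewrite muln_eq0 negb_or lt0n => /andP[].
Qed.

Lemma nedges_all s l h : nedges s l s h + 'C(l, s) = 'C(l + h, s).
Proof.
rewrite [l + h]addnC -binomial.Vandermonde big_ord_recl /= bin0 mul1n subn0 addnC.
congr (_ + _); rewrite /nedges big_add1 big_mkord.
by apply: eq_bigr => i _; rewrite mulnC.
Qed.

(** Edges per added vertex grow with the size of the clique; hence the exponent for a smaller clique
    is no larger than that for [k]. *)
Lemma bin_density s l' l k : 0 < s -> l' <= l -> l <= k ->
  (k - l) * ('C(l, s) - 'C(l', s)) <= (l - l') * ('C(k, s) - 'C(l, s)).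
Proof.
case: s => // s _ l1 l2.
have E a b : a <= b -> 'C(b, s.+1) - 'C(a, s.+1) = \sum_(a <= u < b) 'C(u, s).
  by move=> ab; rewrite !bin_sum_col (big_cat_nat (leq0n a) ab) /= addKn.
rewrite !E //; apply: leq_avg_nondecreasing => // x y; exact: leq_bin2l.
Qed.

End Convexity.

(** * The extension stage *)

Section Prefix.
Variable T : finType.
Implicit Types A : {set T}.

(** A canonical choice of [c] elements of [A], or all of [A] when it has at most [c] elements. *)
Definition pre c A : {set T} := [set x in take c (enum A)].

Lemma pre_sub c A : pre c A \subset A.
Proof. by apply/subsetP => x; rewrite inE => /mem_take; rewrite mem_enum. Qed.

Lemma card_pre c A : #|pre c A| = minn c #|A|.
Proof.
rewrite cardsE; have /card_uniqP -> : uniq (take c (enum A)) by rewrite take_uniq ?enum_uniq.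
by rewrite size_take_min -cardE.
Qed.

Lemma pre_id c A : #|A| <= c -> pre c A = A.
Proof. by move=> Ac; apply/eqP; rewrite eqEcard pre_sub card_pre (minn_idPr Ac) leqnn. Qed.

End Prefix.

Section Chunks.
Variables (T : eqType) (m : nat).

Lemma chunk_mem (i : nat) (u : T) us : u \in take m (drop (i * m) us) ->
  exists2 x, exists y, us = x ++ u :: y & size x %/ m = i.
Proof.
move=> uc; pose j := index u (take m (drop (i * m) us)).
have js : j < size (take m (drop (i * m) us)) by rewrite index_mem.
have jm : j < m by apply: leq_trans js _; rewrite size_take_min geq_minl.
have ju : i * m + j < size us.
  have : j < size us - i * m.
    by apply: leq_trans js _; rewrite size_take_min size_drop geq_minr.
  lia.
exists (take (i * m + j) us); last first.
  by rewrite size_takel ?(ltnW ju) // divnMDl ?divn_small ?addn0 //; lia.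
exists (drop (i * m + j).+1 us); rewrite -{1}(cat_take_drop (i * m + j) us).
congr (_ ++ _); rewrite (drop_nth u) //; congr (_ :: _).
by rewrite -nth_drop -(nth_take _ jm) nth_index.
Qed.

End Chunks.

Lemma chunk_take (T : finType) m i N (us : seq T) :
  i.+1 * m <= N -> chunk m i (take N us) = chunk m i us.
Proof. by move=> iN; rewrite /chunk !take_drop take_takel -?mulSn. Qed.

(** * The game as a function of the random draws *)

Section Game.
Variables n r s : nat.
Local Notation T := {set 'I_n}.

(** An inadmissible answer is replaced by a fixed admissible one, so that any function [g] yields a
    valid player. *)
Definition legal (u v : T) : T :=
  if (#|v| == s - r) && [disjoint u & v] then v else pre (s - r) (~: u).

Lemma legalP (u v : T) : r <= s -> s <= n -> #|u| = r ->
  #|legal u v| = s - r /\ [disjoint u & legal u v].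
Proof.
move=> rs sn ur; rewrite /legal; case: ifP => [/andP[/eqP-> ->] //|_].
rewrite card_pre cardsCs setCK ur card_ord; split; first by apply/minn_idPl; lia.
by rewrite disjoint_sym disjoints_subset pre_sub.
Qed.

(** The player sees only the past draws: its own past answers are determined by them. *)
Fixpoint run (g : seq T -> T -> T) past us : seq T :=
  if us is u :: us' then (u :|: legal u (g past u)) :: run g (rcons past u) us'
  else [::].

Lemma run_cat g (past x y : seq T) : run g past (x ++ y) = run g past x ++ run g (past ++ x) y.
Proof.
elim: x past => [|u x IH] past /=; first by rewrite cats0.
by rewrite IH cat_rcons.
Qed.

Lemma eq_run g g' (p p' us : seq T) :
  (forall x u, size x < size us -> g (p ++ x) u = g' (p' ++ x) u) ->
  run g p us = run g' p' us.
Proof.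
elim: us p p' => //= u us IH p p' H; congr (_ :: _).
  by have := H [::] u isT; rewrite !cats0 => ->.
by apply: IH => x v xs; rewrite !cat_rcons; apply: H.
Qed.

Lemma mem_run g (x : seq T) u y : u :|: legal u (g x u) \in run g [::] (x ++ u :: y).
Proof. by rewrite run_cat mem_cat /= inE eqxx orbT. Qed.

Lemma cliqueP k (E : seq T) : reflect
  (exists2 K : T, #|K| = k & forall e : T, e \subset K -> #|e| = s -> e \in E)
  (contains_clique k s E).
Proof.
apply: (iffP existsP) => [[K /andP[/eqP Kk /forallP H]]|[K Kk H]]; exists K.
- by [].
- by move=> e eK es; apply: (implyP (H e)); rewrite eK es eqxx.
- rewrite Kk eqxx; apply/forallP => e; apply/implyP => /andP[eK /eqP]; exact: H.
Qed.

Lemma sub_clique k (E E' : seq T) : {subset E <= E'} ->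
  contains_clique k s E -> contains_clique k s E'.
Proof. by move=> EE' /cliqueP[K Kk H]; apply/cliqueP; exists K => // e /H{}H /H/EE'. Qed.

End Game.

(** * One extension stage: phases, copies and answers *)

Section Stage.
Variables (n r s h q m : nat) (L : {set 'I_n}) (W : 'I_h -> 'I_q -> 'I_n).
Hypothesis W_inj : forall i j x y, W i x = W j y -> i = j /\ x = y.
Hypothesis W_L : forall i x, W i x \notin L.
Hypothesis rs : r <= s.

(* (J, Q) stands for the edges consisting of Q and of one vertex in each part
   W j, j in J. *)
Local Notation etype := ({set 'I_h} * {set 'I_n})%type.
Local Notation copy := {ffun 'I_h -> 'I_q}.
Implicit Types (a : etype) (phi psi : copy) (us past : seq {set 'I_n}).

Definition type_set : {set etype} :=
  [set a : etype | [&& a.1 != set0, a.2 \subset L & #|a.1| + #|a.2| == s]].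
Definition low a := #|a.1| <= r.
(** The order matters: once a phase of a type that is not [low] begins, all [low] phases are over,
    so presence and isolation of copies are already decided. *)
Definition types : seq etype :=
  enum [set a in type_set | low a] ++ enum [set a in type_set | ~~ low a].

Lemma mem_types a : (a \in types) = (a \in type_set).
Proof. by rewrite mem_cat !mem_enum !inE -andb_orr orbN andbT. Qed.

Lemma uniq_types : uniq types.
Proof.
rewrite cat_uniq !enum_uniq //= andbT; apply/hasPn => a.
by rewrite /= !mem_enum !inE => /andP[_ /negPf->]; rewrite andbF.
Qed.

Lemma index_low a b : a \in types -> b \in types -> low a -> ~~ low b ->
  index a types < index b types.
Proof.
rewrite !mem_types => aT bT la lb.
have aL : a \in enum [set a in type_set | low a] by rewrite mem_enum inE aT.
have bL : b \notin enum [set a in type_set | low a] by rewrite mem_enum inE (negPf lb) andbF.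
by rewrite !index_cat aL (negPf bL); apply: leq_trans (leq_addr _ _); rewrite index_mem.
Qed.

Definition emb phi (J : {set 'I_h}) : {set 'I_n} := [set W i (phi i) | i in J].
(* The r-set that must be drawn in phase a in order to build the edge of type a
   of the copy phi. *)
Definition key a phi := emb phi (pre r a.1) :|: pre (r - #|a.1|) a.2.
Definition edge a phi := emb phi a.1 :|: a.2.
Definition agree phi psi := [set i : 'I_h | phi i == psi i].

Lemma card_emb phi J : #|emb phi J| = #|J|.
Proof. by rewrite card_imset // => i j /W_inj[]. Qed.

Lemma emb_disjoint phi J (Q : {set 'I_n}) : Q \subset L -> [disjoint emb phi J & Q].
Proof.
move=> QL; rewrite disjoints_subset; apply/subsetP => _ /imsetP[i _ ->].
by rewrite inE; apply: contra (W_L i (phi i)) => /(subsetP QL).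
Qed.

Lemma card_embU phi J (Q : {set 'I_n}) : Q \subset L -> #|emb phi J :|: Q| = #|J| + #|Q|.
Proof. by move=> QL; rewrite cardsU (disjoint_setI0 (emb_disjoint _ _ QL)) cards0 subn0 card_emb. Qed.

Lemma type_setP a : a \in types -> [/\ a.1 != set0, a.2 \subset L & #|a.1| + #|a.2| = s].
Proof. by rewrite mem_types inE => /and3P[? ? /eqP]. Qed.

Lemma card_key a phi : a \in types -> #|key a phi| = r.
Proof.
move=> /type_setP[_ aL aS]; rewrite card_embU ?(subset_trans (pre_sub _ _)) // !card_pre.
by move: aS rs; lia.
Qed.

Lemma card_edge a phi : a \in types -> #|edge a phi| = s.
Proof. by move=> /type_setP[_ aL aS]; rewrite card_embU. Qed.

Lemma key_sub_edge a phi : key a phi \subset edge a phi.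
Proof. by rewrite setUSS ?pre_sub // imsetS // pre_sub. Qed.

Lemma key_eq a phi psi : a \in types ->
  (key a phi == key a psi) = (pre r a.1 \subset agree phi psi).
Proof.
move=> /type_setP[_ aL _]; apply/eqP/subsetP => [E i ia|H].
  have : W i (phi i) \in key a psi by rewrite -E inE imset_f.
  rewrite inE => /orP[/imsetP[j _ /W_inj[ij]]|].
    by rewrite inE => ->; rewrite ij.
  by move/(subsetP (pre_sub _ _))/(subsetP aL); rewrite (negPf (W_L _ _)).
congr (_ :|: _); apply: eq_in_imset => i /H; rewrite inE => /eqP ->.
by [].
Qed.

Definition hit a phi us := key a phi \in chunk m (index a types) us.
Definition present us phi := all (fun a => low a ==> hit a phi us) types.
Definition isolated us phi := present us phi &&
  [forall psi, present us psi ==> (psi != phi) ==> (#|agree phi psi| < r)].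
Definition good us phi := isolated us phi && all (fun a => hit a phi us) types.

(** The current phase is read off from the number of past draws. The arbitrary choice made by [pick]
    is harmless, by [edge_eq]. *)
Definition answer past u : {set 'I_n} :=
  let a := nth (set0, set0) types (size past %/ m) in
  if [pick phi | (low a || isolated past phi) && (key a phi == u)] is Some phi
  then edge a phi :\: u else set0.

(** For a [low] type the key contains every vertex of the edge outside [L]. Otherwise equal keys
    force agreement in [r] parts, which isolation of [phi] forbids for any other present copy. *)
Lemma edge_eq a phi psi us : a \in types -> key a phi = key a psi ->
  low a || isolated us phi -> low a || present us psi -> edge a phi = edge a psi.
Proof.
move=> aT /eqP; rewrite key_eq // => ag.
have [la _ _|la /= /andP[_ /forallP/(_ psi)/implyP H] /H] := boolP (low a).
  rewrite /edge; congr (_ :|: _); apply: eq_in_imset => i ia.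
  by have := subsetP ag i; rewrite (pre_id la) inE => /(_ ia)/eqP->.
have [-> //|_ /=] := eqVneq psi phi.
rewrite ltnNge => /negP[]; apply: leq_trans (subset_leq_card ag).
rewrite card_pre leq_min leqnn /= ltnW //; move: la; rewrite /low -ltnNge //.
Qed.

Lemma present_take us a N phi : a \in types -> ~~ low a -> index a types * m <= N ->
  present (take N us) phi = present us phi.
Proof.
move=> aT la aN; apply: eq_in_all => b bT; case lb: (low b) => //=.
rewrite /hit chunk_take //; apply: leq_trans aN; rewrite leq_mul2r.
by rewrite index_low ?orbT.
Qed.

Lemma good_edge us phi a : good us phi -> a \in types ->
  edge a phi \in run r s answer [::] us.
Proof.
move=> /andP[iso /allP hits] aT.
have /chunk_mem[x [y usE] sx] := hits a aT.
(* Isolation as judged at the time of the draw agrees with isolation at the end, since [x] already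
   covers all [low] phases. *)
have isox : low a || isolated x phi.
  have [//|la] := boolP (low a).
  have xE : x = take (size x) us by rewrite usE take_size_cat.
  have pE psi : present x psi = present us psi.
    by rewrite xE (present_take _ _ aT la) // -sx leq_trunc_div.
  rewrite /isolated pE /=; move: iso => /andP[-> /forallP H] /=.
  by apply/forallP => psi; rewrite pE.
rewrite usE.
suff -> : edge a phi = key a phi :|: legal r s (key a phi) (answer x (key a phi)).
  exact: mem_run.
(* The copy picked may differ from [phi], but it leads to the same edge. *)
have ansE : answer x (key a phi) = edge a phi :\: key a phi.
  rewrite /answer sx nth_index //; case: pickP => [psi /andP[ip /eqP kE]|/(_ phi)].
    congr (_ :\: _); apply: (edge_eq aT kE ip).
    by case/orP: isox => [->//|/andP[->]]; rewrite orbT.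
  by rewrite isox eqxx.
rewrite ansE /legal cardsD (setIidPr (key_sub_edge _ _)) card_edge // card_key // eqxx.
rewrite disjoints_subset setCD subsetUr /=.
apply/setP => v; rewrite in_setU in_setD.
by have := subsetP (key_sub_edge a phi) v; case: (v \in key a phi) => [->|].
Qed.

Lemma card_union_copy phi : #|L :|: emb phi [set: 'I_h]| = #|L| + h.
Proof. by rewrite setUC card_embU // cardsT card_ord addnC. Qed.

(** An edge of the new clique has as type the set [J] of parts it meets and its trace on [L]. If [J]
    is empty it lies in [L] and is not the business of this stage. *)
Lemma good_clique us phi (e : {set 'I_n}) : good us phi -> e \subset L :|: emb phi [set: 'I_h] ->
  #|e| = s -> e \subset L \/ e \in run r s answer [::] us.
Proof.
move=> gd eK es; pose J := [set i | W i (phi i) \in e].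
have eE : emb phi J :|: e :&: L = e.
  apply/setP => v; rewrite !inE; apply/orP/idP => [[/imsetP[i]|/andP[]//]|ve].
    by rewrite inE => ? ->.
  have := subsetP eK v ve; rewrite inE => /orP[->|/imsetP[i _ vE]]; first by right; rewrite ve.
  by left; rewrite vE imset_f // inE -vE.
have [J0|J0] := eqVneq J set0.
  by left; rewrite -eE J0 /emb imset0 set0U subsetIr.
right; have aT : (J, e :&: L) \in types.
  by rewrite mem_types inE /= J0 subsetIr -(card_embU phi) ?subsetIr // eE es eqxx.
by have := good_edge gd aT; rewrite /edge /= eE.
Qed.

End Stage.

(** * First and second moments of the extension stage *)

Lemma count_split (T : eqType) (P Q : pred T) (t : seq T) :
  count (fun x => P x && ~~ Q x) t = (count P t - count (fun x => P x && Q x) t)%N.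
Proof.
elim: t => //= x t ->; have : (count (fun y => P y && Q y) t <= count P t)%N.
  by apply: sub_count => y /andP[].
by case: (P x); case: (Q x) => /=; lia.
Qed.

Lemma prod_const (A : pzRingType) (I : Type) (x : A) (t : seq I) :
  (\prod_(i <- t) x = x ^+ size t)%R.
Proof. by elim: t => [|y t IH]; rewrite ?big_nil ?expr0 // big_cons IH exprS. Qed.

Section StageMoments.
Local Open Scope ring_scope.
Variables (n r s h q m : nat) (L : {set 'I_n}) (W : 'I_h -> 'I_q -> 'I_n).
Hypothesis W_inj : forall i j x y, W i x = W j y -> i = j /\ x = y.
Hypothesis W_L : forall i x, W i x \notin L.
Hypothesis rs : (r <= s)%N.

Local Notation etype := ({set 'I_h} * {set 'I_n})%type.
Local Notation copy := {ffun 'I_h -> 'I_q}.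
Local Notation types := (types r s h L).
Local Notation key := (key r W).
Local Notation low := (@low n r h).
Local Notation l := #|L|.
Implicit Types (a : etype) (phi psi : copy) (us : seq {set 'I_n}).

Lemma card_types_in c (I : {set 'I_h}) : (c <= s)%N ->
  #|[set a in type_set s h L | (#|a.1| <= c)%N && (a.1 \subset I)]| = nedges s l c #|I|.
Proof.
move=> cs; rewrite -sum1dep_card.
rewrite (eq_bigl (fun a => [&& a.1 \subset I, 0 < #|a.1| & #|a.1| <= c]%N &&
  ((a.2 \subset L) && (#|a.2| == s - #|a.1|)%N))); last first.
  move=> a; rewrite !inE -card_gt0 -!andbA; case: (a.1 \subset I); rewrite ?andbF //= ?andbT.
  case: leqP => //= a1; case: (_ \subset L) => //=; rewrite ?andbF //=.
  by case: leqP => ac; rewrite ?andbF // andbT; apply/eqP/eqP; lia.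
rewrite -(pair_big_dep (fun J : {set 'I_h} => [&& J \subset I, 0 < #|J| & #|J| <= c]%N)
   (fun J (Q : {set 'I_n}) => (Q \subset L) && (#|Q| == s - #|J|)%N) (fun _ _ => 1%N)) /=.
under eq_bigr do rewrite sum1dep_card cards_draws.
transitivity (\sum_(1 <= j < c.+1) \sum_(J : {set 'I_h} | J \subset I)
   if j == #|J| then 'C(l, s - j)%N else 0%N)%N.
  rewrite exchange_big /= big_mkcondr /=; apply: eq_bigr => J _.
  by rewrite -big_mkcond /= big_nat1_eq ltnS.
apply: eq_bigr => j _; rewrite -big_mkcondr mulnC -(cards_draws I j) -sum_nat_const.
by apply: eq_bigl => J; rewrite !inE; congr (_ && _); rewrite eq_sym.
Qed.

Lemma count_types (P : pred etype) : count P types = #|[set a in type_set s h L | P a]|.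
Proof.
rewrite -size_filter; have /card_uniqP <- : uniq (filter P types).
  by rewrite filter_uniq ?uniq_types.
by apply: eq_card => a; rewrite mem_filter mem_types [RHS]inE andbC.
Qed.

Lemma size_types : size types = nedges s l s h.
Proof.
rewrite -(count_predT types) count_types -[in RHS](card_ord h) -cardsT -card_types_in //.
apply: eq_card => a; rewrite !inE subsetT !andbT.
apply/idP/andP => [H|[]//]; split=> //.
by move: H => /and3P[_ _ /eqP <-]; exact: leq_addr.
Qed.

Lemma count_low (I : {set 'I_h}) :
  count (fun a => low a && (a.1 \subset I)) types = nedges s l r #|I|.
Proof. by rewrite count_types card_types_in. Qed.

Lemma count_low_neq phi psi :
  count (fun a => low a && (key a phi != key a psi)) types
  = (nedges s l r h - nedges s l r #|agree phi psi|)%N.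
Proof.
rewrite count_split -count_low.
have -> : nedges s l r h = count low types.
  rewrite -[in LHS](card_ord h) -cardsT -count_low; apply: eq_count => a.
  by rewrite subsetT andbT.
congr (_ - _)%N; apply: eq_in_count => a aT /=.
by rewrite (key_eq W_inj W_L _ _ aT); case la: (low a) => //=; rewrite pre_id.
Qed.

(** Keys of types that are not [low] fix [r] parts, so they always differ here; only [low] types
    supported on the agreement set share a key. *)
Lemma count_neq phi psi : (#|agree phi psi| < r)%N ->
  count (fun a => key a phi != key a psi) types
  = (nedges s l s h - nedges s l r #|agree phi psi|)%N.
Proof.
move=> ag; rewrite -size_types -(count_predT types) -count_low.
rewrite -(eq_count (a1 := fun a => predT a && (key a phi != key a psi))) // count_split.
congr (_ - _)%N; apply: eq_in_count => a aT /=.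
rewrite (key_eq W_inj W_L _ _ aT); have [la|la] /= := boolP (low a); first by rewrite pre_id.
apply/negP => /subset_leq_card; rewrite card_pre leqNgt => /negP[].
by apply: leq_trans ag _; rewrite leq_min leqnn ltnW // ltnNge.
Qed.

Variable R : realFieldType.
Local Notation Om := [set U : {set 'I_n} | #|U| == r].
Local Notation E := (@Ex R _ Om).
Local Notation e := (nedges s l s h).
Local Notation e0 := (nedges s l r).
Let p : R := m%:R / #|Om|%:R.

Hypothesis rn : (r <= n)%N.

Lemma Om_gt0 : (0 < #|Om|)%N.
Proof.
have -> : #|Om| = 'C(n, r) by rewrite card_draws card_ord.
by rewrite bin_gt0.
Qed.

Lemma key_Om a phi : a \in types -> key a phi \in Om.
Proof. by move=> aT; rewrite inE (card_key W_inj W_L rs _ aT). Qed.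

Lemma p_ge0 : 0 <= p. Proof. by rewrite divr_ge0. Qed.

Lemma Ex_types (Q : etype -> pred (seq {set 'I_n})) :
  E (size types * m) (fun us => (all (fun a => Q a (chunk m (index a types) us)) types)%:R)
  = \prod_(a <- types) E m (fun w => (Q a w)%:R).
Proof.
rewrite (big_nth (set0, set0)) big_mkord.
rewrite -(Ex_chunks Om (size types) m (fun i w => (Q (nth (set0, set0) types i) w)%:R)).
apply: Ex_eq => us _ _.
have -> (t : seq etype) (P : pred etype) : (all P t)%:R = \prod_(a <- t) (P a)%:R :> R.
  elim: t => [|a t IH] /=; first by rewrite big_nil.
  by rewrite big_cons -IH; case: (P a); rewrite ?mul1r ?mul0r.
rewrite (big_nth (set0, set0)) big_mkord; apply: eq_bigr => i _.
by rewrite index_uniq ?uniq_types.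
Qed.

Definition all_hit phi us := all (fun a => hit r s m L W a phi us) types.

Lemma Ex_all_hit_ge (alpha : R) phi : 0 <= alpha ->
  (forall u, u \in Om -> alpha * p <= E m (fun w => (u \in w)%:R)) ->
  (alpha * p) ^+ e <= E (size types * m) (fun us => (all_hit phi us)%:R).
Proof.
move=> al H; rewrite (Ex_types (fun a w => key a phi \in w)) -size_types -prod_const.
rewrite big_seq [leRHS]big_seq; apply: ler_prod => a aT.
by rewrite mulr_ge0 ?p_ge0 // H // key_Om.
Qed.

(** Phases are independent: a type costs [p ^+ 2] if both copies require it with different keys, and
    [p] otherwise. [B] selects the edges required of [psi]: the [low] ones for presence, all of them
    for completion. *)
Lemma Ex_pair_le (B : pred etype) phi psi :
  E (size types * m) (fun us => (all_hit phi us &&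
      all (fun a => B a ==> hit r s m L W a psi us) types)%:R)
  <= p ^+ (e + count (fun a => B a && (key a phi != key a psi)) types).
Proof.
rewrite (Ex_eq (g := fun us => (all (fun a =>
   (fun w => (key a phi \in w) && (B a ==> (key a psi \in w)))
     (chunk m (index a types) us)) types)%:R)); last first.
  by move=> us _ _; rewrite -all_predI.
rewrite (Ex_types (fun a w => (key a phi \in w) && (B a ==> (key a psi \in w)))).
rewrite exprD -size_types -prod_const -sum1_count expr_sum [X in _ * X]big_mkcond -big_split /=.
rewrite big_seq [leRHS]big_seq; apply: ler_prod => a aT.
rewrite -[X in X <= _](Ex_cst Om_gt0 m) Ex_le //=.
have kO := key_Om _ aT; case: (B a) => /=.
  have [->|kk] := eqVneq (key a phi) (key a psi).
    rewrite mulr1; apply: le_trans (Ex_hit_le _ Om_gt0 m (kO psi)).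
    by apply: Ex_le => w _ _; rewrite andbb.
  by rewrite expr1 -expr2; apply: Ex_hit2_le; rewrite ?Om_gt0 ?kO.
rewrite mulr1; apply: le_trans (Ex_hit_le _ Om_gt0 m (kO phi)).
by apply: Ex_le => w _ _; rewrite andbT.
Qed.

Lemma card_agree phi (I : {set 'I_h}) :
  (#|[set psi | agree phi psi == I]| <= q ^ (h - #|I|))%N.
Proof.
pose F (i : 'I_h) : pred 'I_q := if i \in I then pred1 (phi i) else predT.
apply: (@leq_trans #|family F|).
  apply: subset_leq_card; apply/subsetP => psi; rewrite inE => /eqP agE.
  by apply/familyP => i; rewrite /F -agE inE; case: eqP => [->|] //; rewrite inE.
rewrite card_family foldrE big_map big_enum /=.
rewrite (eq_bigr (fun i => if i \in ~: I then q else 1%N)); last first.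
  by move=> i _; rewrite /F inE; case: (i \in I); rewrite ?card1 ?card_ord.
by rewrite -big_mkcond prod_nat_const cardsCs setCK card_ord.
Qed.

(** Group the copies by agreement set: there are [2 ^ h] sets [I], each shared by at most
    [q ^ (h - #|I|)] copies. *)
Lemma sum_agree_le phi (P : pred nat) (f : nat -> R) (c : R) : 0 <= c ->
  (forall i, (i <= h)%N -> P i -> 0 <= f i) ->
  (forall i, (i <= h)%N -> P i -> q%:R ^+ (h - i) * f i <= c) ->
  \sum_(psi | P #|agree phi psi|) f #|agree phi psi| <= (2 ^ h)%:R * c.
Proof.
move=> c0 f0 H.
have cI (I : {set 'I_h}) : (#|I| <= h)%N by rewrite -[leqRHS](card_ord h) max_card.
rewrite (partition_big (agree phi) (fun I => P #|I|)) //=.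
have -> : (2 ^ h)%:R * c = \sum_(I : {set 'I_h}) c.
  rewrite sumr_const mulr_natl; congr (_ *+ _).
  by rewrite -cardsT -powersetT card_powerset cardsT card_ord.
rewrite [leLHS]big_mkcond; apply: ler_sum => I _; case: ifP => // PI.
rewrite (eq_bigr (fun=> f #|I|)); last by move=> psi /andP[_ /eqP->].
rewrite sumr_const; apply: le_trans (H _ (cI I) PI); rewrite -[leLHS]mulr_natl.
rewrite ler_wpM2r ?f0 // -natrX ler_nat; apply: leq_trans (card_agree phi I).
by apply: subset_leq_card; apply/subsetP => psi; rewrite !inE => /andP[].
Qed.

Definition ngood us : R := \sum_phi (good r s m L W us phi)%:R.

Lemma card_copy : #|copy|%:R = q%:R ^+ h :> R.
Proof. by rewrite card_ffun !card_ord natrX. Qed.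

Lemma agree_lt phi psi : psi != phi -> (#|agree phi psi| < h)%N.
Proof.
have agh : (#|agree phi psi| <= h)%N by rewrite -[leqRHS](card_ord h) max_card.
rewrite ltn_neqAle agh andbT; apply: contra => /eqP agE.
apply/eqP/ffunP => i; have : agree phi psi = setT.
  by apply/eqP; rewrite eqEcard subsetT cardsT card_ord agE leqnn.
by move/setP/(_ i); rewrite !inE => /eqP.
Qed.

(** A completed copy is good unless another present copy shares at least [r] vertices with it. A
    union bound over such copies, each weighed by [He], gives the subtracted term. *)
Lemma Ex_ngood_ge (alpha eta : R) : 0 <= alpha -> 0 <= eta ->
  (forall u, u \in Om -> alpha * p <= E m (fun w => (u \in w)%:R)) ->
  (forall i, (r <= i < h)%N -> q%:R ^+ (h - i) * p ^+ (e0 h - e0 i) <= eta) ->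
  q%:R ^+ h * p ^+ e * (alpha ^+ e - (2 ^ h)%:R * eta) <= E (size types * m) ngood.
Proof.
move=> al et Hh He; rewrite /ngood Ex_sum -card_copy -mulrA mulr_natl -sumr_const.
apply: ler_sum => phi _.
pose Q psi := (r <= #|agree phi psi| < h)%N.
apply: le_trans (_ : E (size types * m) (fun us => (all_hit phi us)%:R
   - \sum_(psi | Q psi) (all_hit phi us && present r s m L W us psi)%:R) <= _).
  rewrite ExB Ex_sum mulrBr -exprMn [p * _]mulrC; apply: lerB; first exact: Ex_all_hit_ge.
  apply: le_trans (_ : \sum_(psi | Q psi) p ^+ (e + (e0 h - e0 #|agree phi psi|)) <= _).
    by apply: ler_sum => psi _; rewrite -count_low_neq; exact: Ex_pair_le.
  rewrite mulrCA; apply: (@sum_agree_le phi (fun i => r <= i < h)%N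
     (fun i => p ^+ (e + (e0 h - e0 i)))) => [|i ih _|i ih iP].
  - by rewrite mulr_ge0 // exprn_ge0 // p_ge0.
  - by rewrite exprn_ge0 // p_ge0.
  - by rewrite exprD mulrCA ler_wpM2l ?exprn_ge0 ?p_ge0 // He.
apply: Ex_le => us _ _; rewrite lerBlDr.
have [ah|nah] /= := boolP (all_hit phi us); last by rewrite ler_wpDr // sumr_ge0.
have [gd|] := boolP (good _ _ _ _ _ us phi); first by rewrite ler_wpDr // sumr_ge0.
rewrite /good -/(all_hit phi us) ah andbT /isolated negb_and.
have pr : present r s m L W us phi.
  by apply/allP => a aT; rewrite (allP ah a aT) implybT.
rewrite pr /= => /forallPn[psi]; rewrite !negb_imply => /and3P[pp pn ag].
have Qp : Q psi by rewrite /Q leqNgt ag agree_lt.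
by rewrite (bigD1 psi) //= pp addrA add0r ler_wpDr ?sumr_ge0.
Qed.

(** Two distinct good copies share fewer than [r] vertices by isolation, so only the diagonal and
    such pairs contribute. *)
Lemma Ex_ngood2_le (kappa : R) : 0 <= kappa ->
  (forall i, (i <= h)%N -> (i < r)%N -> q%:R ^+ (h - i) * p ^+ (e - e0 i) <= kappa) ->
  E (size types * m) (fun us => ngood us ^+ 2)
  <= q%:R ^+ h * p ^+ e * (1 + (2 ^ h)%:R * kappa).
Proof.
move=> ka Hk.
apply: le_trans (_ : E (size types * m) (fun us => \sum_phi ((all_hit phi us)%:R
   + \sum_(psi | (#|agree phi psi| < r)%N) (all_hit phi us && all_hit psi us)%:R)) <= _).
  apply: Ex_le => us _ _; rewrite expr2 /ngood mulr_suml; apply: ler_sum => phi _.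
  have [gd|] := boolP (good _ _ _ _ _ us phi); last first.
    by rewrite mul0r addr_ge0 // sumr_ge0.
  have /andP[iso ah] := gd; rewrite mul1r -/(all_hit phi us) in ah *.
  rewrite (bigD1 phi) //= gd ah lerD2l.
  rewrite [leRHS]big_mkcond [leLHS]big_mkcond; apply: ler_sum => psi _.
  have [->|pn] := eqVneq psi phi; first by case: ifP.
  have [gp|_] := boolP (good _ _ _ _ _ us psi); last by case: ifP.
  have /andP[/andP[pp _] ap] := gp; move: iso => /andP[_ /forallP/(_ psi)].
  by rewrite pp pn /= => ->; rewrite /all_hit ap.
rewrite Ex_sum -card_copy -mulrA mulr_natl -sumr_const.
apply: ler_sum => phi _; rewrite ExD mulrDr mulr1; apply: lerD.
  apply: le_trans (_ : \prod_(a <- types) p <= _); last by rewrite prod_const size_types.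
  rewrite (Ex_types (fun a w => key a phi \in w)) big_seq [leRHS]big_seq.
  apply: ler_prod => a aT; rewrite -[X in X <= _](Ex_cst Om_gt0 m) Ex_le //=.
  exact: (Ex_hit_le _ Om_gt0 m (key_Om phi aT)).
rewrite Ex_sum.
apply: le_trans (_ : \sum_(psi | (#|agree phi psi| < r)%N) p ^+ (e + (e - e0 #|agree phi psi|)) <= _).
  apply: ler_sum => psi ag; rewrite -count_neq //.
  exact: (Ex_pair_le (fun=> true) phi psi).
rewrite mulrCA; apply: (@sum_agree_le phi (fun i => i < r)%N (fun i => p ^+ (e + (e - e0 i)))).
- by rewrite mulr_ge0 // exprn_ge0 // p_ge0.
- by move=> i _ _; rewrite exprn_ge0 // p_ge0.
- by move=> i ih ir; rewrite exprD mulrCA ler_wpM2l ?exprn_ge0 ?p_ge0 // Hk.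
Qed.

Lemma ngood_neq0 us : ngood us != 0 -> exists phi, good r s m L W us phi.
Proof.
move=> nz; apply/existsP; apply: contraR nz => /existsPn H.
by rewrite /ngood big1 // => phi _; rewrite (negPf (H phi)).
Qed.

End StageMoments.

(** * Success probability of the extension stage *)

Lemma disjoint_parts n h q (L : {set 'I_n}) : h * q <= n - #|L| ->
  exists2 W : 'I_h -> 'I_q -> 'I_n,
    forall i j x y, W i x = W j y -> i = j /\ x = y & forall i x, W i x \notin L.
Proof.
move=> hq; have cL : n - #|L| = #|~: L| by rewrite [RHS]cardsCs setCK card_ord.
have pf (i : 'I_h) (x : 'I_q) : i * q + x < #|~: L|.
  rewrite -cL; apply: leq_trans hq; apply: (@leq_trans (i.+1 * q)).
    by rewrite mulSn addnC ltn_add2r.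
  by rewrite leq_mul2r ltn_ord orbT.
exists (fun i x => enum_val (Ordinal (pf i x))) => [i j x y /enum_val_inj[] E|i x].
  have q0 : 0 < q by apply: leq_ltn_trans (ltn_ord x).
  split; apply: val_inj => /=.
    by have /(congr1 (divn^~ q)) := E; rewrite !divnMDl // !divn_small // !addn0.
  by have /(congr1 (modn^~ q)) := E; rewrite !modnMDl !modn_small.
by have := enum_valP (Ordinal (pf i x)); rewrite inE.
Qed.

(** Each factor [n - i] is at least [n / 2]. With [leq_bin_expn] this places ['C(n, r)] between
    constant multiples of [n ^ r]. *)
Lemma expn_leq_ffact n r : 2 * r <= n -> n ^ r <= 2 ^ r * n ^_ r.
Proof.
move=> rn; rewrite ffact_prod -[r in n ^ r]card_ord -[r in 2 ^ r]card_ord -!prod_nat_const.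
rewrite -big_split /=; apply: leq_prod => i _; have := ltn_ord i; lia.
Qed.

Lemma leq_bin_expn n r : 'C(n, r) <= n ^ r.
Proof.
apply: leq_trans (_ : n ^_ r <= _); first by rewrite -bin_ffact leq_pmulr ?fact_gt0.
rewrite ffact_prod -[r in n ^ r]card_ord -prod_nat_const.
by apply: leq_prod => i _; rewrite leq_subr.
Qed.

Section Extend.
Variables (n s : nat) (L : {set 'I_n}) (k : nat).
Definition extends (E : seq {set 'I_n}) :=
  [exists K : {set 'I_n}, [&& L \subset K, #|K| == k &
    [forall e : {set 'I_n}, (e \subset K) && (#|e| == s) ==> (e \subset L) || (e \in E)]]].
End Extend.

Section StageConstants.
Local Open Scope ring_scope.
Variable R : realFieldType.

(** Here [y] plays the part of n^(h/e); raising to the power [e] avoids fractional exponents. *)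
Lemma ler_root_expn (y : R) n a b e h : (0 < e)%N -> (0 < n)%N -> 0 <= y ->
  y ^+ e = n%:R ^+ h -> (a * e <= h * b)%N -> n%:R ^+ a <= y ^+ b.
Proof.
move=> e0 n0 y0 ye ab; rewrite -(ler_pXn2r e0) ?nnegrE ?exprn_ge0 //.
by rewrite -!exprM [(b * e)%N]mulnC [y ^+ _]exprM ye -exprM ler_weXn2l // ler1n.
Qed.

Variables (r s l h : nat).
Hypothesis r0 : (0 < r)%N.
Hypothesis rs : (r <= s)%N.
Hypothesis rh : (r <= h)%N.
Local Notation e := (nedges s l s h).
Local Notation e0 := (nedges s l r).
Hypothesis e_gt0 : (0 < e)%N.
Hypothesis ext : ((h - r) * e <= h * (e0 h - e0 r))%N.

Local Notation K := (2 ^ r * r`!)%N.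
(** The ratio of squared first moment to second moment, with [q ^ h * p ^ e] replaced by its
    constant lower bound. *)
Definition stage_delta (c alpha eta : R) : R :=
  (4 * h)%:R ^- h * c ^+ e * (alpha ^+ e - (2 ^ h)%:R * eta) ^+ 2
    / (1 + (2 ^ h)%:R * (2 * K)%:R ^+ e).

(** Since [y] is n^(h/e), the phase length is of order n^(r - h/e), and [p] lies between [c / y] and
    [2 c K / y]. All powers of [n] then cancel in the two moments. *)
Lemma stage_success (c alpha eta y : R) (n m : nat) (L : {set 'I_n}) :
  0 < c -> c <= 1 -> 0 < alpha -> alpha * (1 + 2 * c * K%:R) <= 1 ->
  0 <= eta -> 0 < alpha ^+ e - (2 ^ h)%:R * eta ->
  ((r < h)%N -> 2 * c * K%:R <= eta /\ eta <= 1) ->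
  #|L| = l -> (2 * l <= n)%N -> (4 * h <= n)%N -> (2 * r <= n)%N ->
  0 < y -> y ^+ e = n%:R ^+ h ->
  c * (n%:R ^+ r / y) <= m%:R -> m%:R <= 2 * c * (n%:R ^+ r / y) ->
  exists g, stage_delta c alpha eta <=
    Ex [set U : {set 'I_n} | #|U| == r] (e * m)
       (fun us => (extends s L (l + h) (run r s g [::] us))%:R).
Proof.
move=> c0 c1 al0 alc et0 be0 etc Ll nl nh nr y0 ye mlo mhi.
have h0 : (0 < h)%N by apply: leq_trans rh.
have n0 : (0 < n)%N by lia.
have rn : (r <= n)%N by lia.
pose q := ((n - l) %/ h)%N.
have hq : (h * q <= n - #|L|)%N by rewrite Ll mulnC leq_trunc_div.
(* Indeed [h * q > n - l - h], which is at least [n / 4] by the assumptions on [n]. *)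
have nq : (n <= 4 * h * q)%N.
  have := ltn_ceil (n - l) h0; rewrite -/q => H.
  have : (q.+1 * h = h * q + h)%N by rewrite mulSn mulnC addnC.
  have -> : (4 * h * q = 4 * (h * q))%N by rewrite mulnA.
  lia.
have qn : (q <= n)%N by apply: leq_trans (leq_div _ _) (leq_subr _ _).
have [W W_inj W_L] := disjoint_parts hq.
exists (answer r s m L W).
set Om := [set U : {set 'I_n} | _].
have cOm : #|Om| = 'C(n, r) by rewrite card_draws card_ord.
have Om0 : (0 < #|Om|)%N := Om_gt0 rn.
have N0 : 0 < #|Om|%:R :> R by rewrite ltr0n.
set p : R := m%:R / #|Om|%:R.
have p0 : 0 <= p by rewrite divr_ge0.
have nR : 0 < n%:R :> R by rewrite ltr0n.
have y1 : 1 <= y.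
  by rewrite -(ler_pXn2r e_gt0) ?nnegrE ?(ltW y0) // ye expr1n exprn_ege1 // ler1n.
have K1 : 1 <= K%:R :> R by rewrite ler1n muln_gt0 expn_gt0 fact_gt0.
have plo : c / y <= p.
  rewrite /p ler_pdivlMr //; apply: le_trans mlo; rewrite mulrAC -mulrA.
  by rewrite ler_wpM2l ?(ltW c0) // ler_pM2r ?invr_gt0 // -natrX ler_nat cOm leq_bin_expn.
have phi : p <= 2 * c * K%:R / y.
  rewrite /p ler_pdivrMr //; apply: le_trans mhi _.
  rewrite [leRHS](_ : _ = 2 * c * (K%:R * #|Om|%:R / y)); last by ring.
  rewrite ler_wpM2l ?mulr_ge0 ?(ltW c0) // ler_pM2r ?invr_gt0 //.
  rewrite -natrX -natrM ler_nat cOm -mulnA [(r`! * _)%N]mulnC bin_ffact.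
  exact: expn_leq_ffact.
have cK0 : 0 <= 2 * c * K%:R by rewrite !mulr_ge0 ?(ltW c0).
have pK : p <= 2 * c * K%:R.
  by apply: le_trans phi _; rewrite ler_pdivrMr // ler_peMr.
have hit u : u \in Om -> alpha * p <= Ex Om m (fun w => (u \in w)%:R).
  move=> uO; apply: le_trans (Ex_hit_ge R Om0 m uO).
  rewrite -/p mulrC ler_wpM2l // -[X in _ <= X]mul1r.
  rewrite ler_pdivlMr; last by lra.
  apply: le_trans alc.
  by rewrite ler_pM2l // lerD2l.
have powbound i d : ((h - i) * e <= h * d)%N ->
    q%:R ^+ (h - i) * p ^+ d <= (2 * c * K%:R) ^+ d.
  move=> hid; apply: le_trans (_ : y ^+ d * (2 * c * K%:R / y) ^+ d <= _).
    apply: ler_pM; rewrite ?exprn_ge0 //; last by rewrite lerXn2r ?nnegrE // (le_trans p0).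
    apply: le_trans (ler_root_expn e_gt0 n0 (ltW y0) ye hid).
    by rewrite lerXn2r ?nnegrE // ler_nat.
  by rewrite -exprMn mulrC divfK // gt_eqF.
(* The exponent of [p] is at least 1, so a single factor [2 c K <= eta] suffices. *)
have lowb i : (r <= i < h)%N -> q%:R ^+ (h - i) * p ^+ (e0 h - e0 i) <= eta.
  move=> /andP[ri ih]; have rh' := leq_ltn_trans ri ih; have [cKe e1] := etc rh'.
  have H := nedges_extension ri (ltnW ih) ext.
  have d0 : (0 < e0 h - e0 i)%N.
    rewrite lt0n; apply: contraTneq H => ->; rewrite muln0 -ltnNge muln_gt0 subn_gt0 ih.
    exact: e_gt0.
  apply: le_trans (powbound _ _ H) _; apply: (le_trans _ cKe).
  by rewrite -[leRHS]expr1 ler_wiXn2l // (le_trans cKe).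
have k2 : (2 * K)%:R = 2 * K%:R :> R by rewrite [LHS]natrM.
have cK2 : 2 * c * K%:R <= (2 * K)%:R by rewrite k2; nra.
set kappa : R := (2 * K)%:R ^+ e.
have kap0 : 0 <= kappa by rewrite exprn_ge0.
have kapb i : (i <= h)%N -> (i < r)%N -> q%:R ^+ (h - i) * p ^+ (e - e0 i) <= kappa.
  move=> ih ir; apply: le_trans (powbound _ _ _) _.
    rewrite mulnBl mulnBr leq_sub2l //; exact: nedges_density.
  apply: le_trans (_ : (2 * K)%:R ^+ (e - e0 i) <= _).
    by rewrite lerXn2r ?nnegrE.
  by rewrite ler_weXn2l ?leq_subr // k2; lra.
pose M : R := q%:R ^+ h * p ^+ e.
have sizeT : size (types r s h L) = e by rewrite (size_types h L rs) Ll.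
have EX := Ex_ngood_ge W_inj W_L rs rn (ltW al0) et0 hit.
rewrite Ll sizeT -/M in EX.
have EX2 := Ex_ngood2_le (m := m) W_inj W_L rs rn kap0.
rewrite Ll sizeT -/M in EX2.
(* Uses [q >= n / (4h)], [p >= c / y] and [y ^+ e = n ^ h]. *)
have cy : (4 * h)%:R ^- h * c ^+ e <= M.
  apply: le_trans (_ : ((n%:R / (4 * h)%:R) ^+ h * (c / y) ^+ e) <= _).
    rewrite !expr_div_n ye [X in _ <= X](_ : _ = (4 * h)%:R ^- h * c ^+ e) //.
    by field; rewrite !expf_neq0 // ?pnatr_eq0 -?lt0n ?muln_gt0.
  apply: ler_pM; rewrite ?exprn_ge0 ?divr_ge0 ?(ltW c0) ?(ltW y0) //.
    rewrite lerXn2r ?nnegrE ?divr_ge0 // ler_pdivrMr ?ltr0n ?muln_gt0 //.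
    by rewrite -natrM ler_nat mulnC.
  by rewrite lerXn2r ?nnegrE ?divr_ge0 ?(ltW c0) ?(ltW y0).
have M0 : 0 < M.
  apply: lt_le_trans cy; rewrite mulr_gt0 ?invr_gt0 ?exprn_gt0 // ltr0n muln_gt0 //.
set be := alpha ^+ e - _ in be0 EX *.
have b0 : 0 < 1 + (2 ^ h)%:R * kappa by rewrite ltr_pwDl // mulr_ge0.
have SM := Ex_second_moment Om0 (mulr_gt0 M0 be0) (mulr_gt0 M0 b0) (EX lowb) (EX2 kapb).
apply: (le_trans _ (le_trans SM _)).
  rewrite [leRHS](_ : _ = M * (be ^+ 2 / (1 + (2 ^ h)%:R * kappa))).
    by rewrite /stage_delta -/kappa -/be -[leLHS]mulrA ler_wpM2r // divr_ge0 ?sqr_ge0 // ltW.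
  by field; rewrite !gt_eqF.
apply: Ex_le => us sus _; have [nz|] := boolP (_ != 0); last by [].
have [ph gd] := ngood_neq0 nz.
rewrite ler_nat lt0b; apply/existsP; exists (L :|: emb W ph setT).
rewrite subsetUl card_union_copy // Ll eqxx; apply/forallP => f.
apply/implyP => /andP[fK /eqP fs].
by apply/orP; exact: good_clique gd fK fs.
Qed.

End StageConstants.

(** * Sequences of stages and of blocks *)

Section Blocks.
Variables (n r s B : nat) (g : seq {set 'I_n} -> {set 'I_n} -> {set 'I_n}).

(** Forgets all draws before the current block of length [B], so the blocks are independent
    attempts. *)
Definition restart (past : seq {set 'I_n}) := g (drop (size past %/ B * B) past).

Lemma run_restart b i us : 0 < B -> i < b -> b * B <= size us ->
  {subset run r s g [::] (chunk B i us) <= run r s restart [::] us}.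
Proof.
move=> B0 ib bu; have iu : i * B <= size us by apply: leq_trans bu; rewrite leq_mul2r ltnW ?orbT.
rewrite -{2}(cat_take_drop (i * B) us) -(cat_take_drop B (drop (i * B) us)) -/(chunk B i us).
rewrite !run_cat /= => e ein; rewrite !mem_cat; apply/orP; right; apply/orP; left.
rewrite (@eq_run _ _ _ _ g _ [::]) // => x u xs.
have xB : size x < B by apply: leq_trans xs _; rewrite /chunk size_take_min geq_minl.
rewrite /restart size_cat size_takel // divnMDl // divn_small // addn0.
by rewrite drop_size_cat // size_takel.
Qed.

Local Open Scope ring_scope.
Variable R : realFieldType.
Local Notation Om := [set U : {set 'I_n} | #|U| == r].

(** Failure overall forces failure in each of the first [b] blocks; later draws can only help. *)
Lemma Ex_restart (k b t : nat) (delta : R) : (r <= n)%N -> (0 < B)%N -> (b * B <= t)%N ->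
  delta <= Ex Om B (fun us => (contains_clique k s (run r s g [::] us))%:R) -> delta <= 1 ->
  1 - (1 - delta) ^+ b <=
    Ex Om t (fun us => (contains_clique k s (run r s restart [::] us))%:R).
Proof.
move=> rn B0 bt dl d1; have Om0 := Om_gt0 rn.
pose F us : R := 1 - (contains_clique k s (run r s g [::] us))%:R.
have FE : Ex Om B F <= 1 - delta by rewrite ExB (Ex_cst Om0) lerB.
have F0 us : 0 <= F us by rewrite /F; case: (contains_clique _ _ _); rewrite ?subrr ?subr0.
have EF0 : 0 <= Ex Om B F by rewrite -[X in X <= _](Ex_cst Om0 B); apply: Ex_le.
rewrite lerBlDr -lerBlDl -[X in X - _](Ex_cst Om0 t) -ExB.
apply: le_trans (_ : \prod_(i < b) Ex Om B F <= _); last first.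
  by rewrite prodr_const card_ord lerXn2r ?nnegrE ?subr_ge0.
rewrite -(Ex_chunks Om b B (fun=> F)) -(Ex_take Om0 (b * B) (t - b * B)) subnKC //.
apply: Ex_le => us sus _; have [cl|ncl] := boolP (contains_clique _ _ _).
  by rewrite subrr prodr_ge0.
rewrite subr0 big1 // => i _; rewrite /F.
have -> : chunk B i (take (b * B) us) = chunk B i us.
  by apply: chunk_take; rewrite leq_mul2r ltn_ord orbT.
case cl: (contains_clique _ _ _); last by rewrite subr0.
move: ncl; rewrite (sub_clique _ cl) //; apply: (@run_restart b) => //.
by rewrite sus.
Qed.

End Blocks.

Section Sequel.
Variables (n r s l h B1 B2 : nat) (g1 : seq {set 'I_n} -> {set 'I_n} -> {set 'I_n}).
Variable G : {set 'I_n} -> seq {set 'I_n} -> {set 'I_n} -> {set 'I_n}.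

Definition found (E : seq {set 'I_n}) : {set 'I_n} :=
  odflt set0 [pick K : {set 'I_n} | (#|K| == l) &&
    [forall e : {set 'I_n}, (e \subset K) && (#|e| == s) ==> (e \in E)]].

(** The second stage recovers its base clique by replaying the first [B1] draws. *)
Definition sequel past u :=
  if size past < B1 then g1 past u
  else G (found (run r s g1 [::] (take B1 past))) (drop B1 past) u.

Lemma foundP E : contains_clique l s E ->
  #|found E| = l /\ forall e : {set 'I_n}, e \subset found E -> #|e| = s -> e \in E.
Proof.
move=> /existsP[K HK]; rewrite /found; case: pickP => [K'|/(_ K)] /=; last by rewrite HK.
move=> /andP[/eqP Kl /forallP H]; split=> // e eK es.
by apply: (implyP (H e)); rewrite eK es eqxx.
Qed.

Lemma sequel_clique x y : size x = B1 ->
  contains_clique l s (run r s g1 [::] x) ->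
  extends s (found (run r s g1 [::] x)) (l + h)
     (run r s (G (found (run r s g1 [::] x))) [::] y) ->
  contains_clique (l + h) s (run r s sequel [::] (x ++ y)).
Proof.
move=> sx /foundP[]; set L := found _ => Ll HL /existsP[K /and3P[LK /eqP cK /forallP HK]].
apply/cliqueP; exists K => // e eK es.
have := implyP (HK e); rewrite eK es eqxx => /(_ isT).
rewrite run_cat mem_cat => /orP[eL|eE]; apply/orP; [left|right].
  rewrite (@eq_run _ _ _ _ g1 _ [::]) ?HL // => z u zx.
  by rewrite /sequel /= -sx zx.
rewrite (@eq_run _ _ _ _ (G L) _ [::]) // => z u zy.
by rewrite /sequel /= size_cat -sx ltnNge leq_addr take_size_cat // drop_size_cat.
Qed.

Local Open Scope ring_scope.
Variable R : realFieldType.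
Local Notation Om := [set U : {set 'I_n} | #|U| == r].

(** Condition on the first [B1] draws; the bound [d2] is uniform in the clique [L] that they
    produce. *)
Lemma Ex_sequel (d1 d2 : R) : 0 <= d2 ->
  d1 <= Ex Om B1 (fun us => (contains_clique l s (run r s g1 [::] us))%:R) ->
  (forall L : {set 'I_n}, #|L| = l ->
     d2 <= Ex Om B2 (fun us => (extends s L (l + h) (run r s (G L) [::] us))%:R)) ->
  (r <= n)%N ->
  d2 * d1 <= Ex Om (B1 + B2)
    (fun us => (contains_clique (l + h) s (run r s sequel [::] us))%:R).
Proof.
move=> d20 H1 H2 rn; have Om0 := Om_gt0 rn.
apply: le_trans (ler_wpM2l d20 H1) _; rewrite -ExZ Ex_cat; apply: Ex_le => x sx _.
have [cl|_] := boolP (contains_clique _ _ _); last first.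
  by rewrite mulr0 -[X in X <= _](Ex_cst Om0 B2); apply: Ex_le.
rewrite mulr1; have [fl _] := foundP cl; apply: le_trans (H2 _ fl) _; apply: Ex_le => y _ _.
have [ex|] := boolP (extends _ _ _ _); last by [].
by rewrite sequel_clique.
Qed.

End Sequel.

(** * Recursive construction of cliques at a given rate *)

Section Rates.
Local Open Scope ring_scope.
Variable R : archiRealFieldType.

Definition builds (r s k : nat) (Y : nat -> R) : Prop :=
  exists (C delta : R) (N : nat), [/\ 0 < C, 0 < delta & forall n, (N <= n)%N ->
    exists (B : nat) (g : seq {set 'I_n} -> {set 'I_n} -> {set 'I_n}),
    [/\ (0 < B)%N, B%:R <= C * Y n & delta <= Ex [set U : {set 'I_n} | #|U| == r] B
      (fun us => (contains_clique k s (run r s g [::] us))%:R)]].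

Lemma builds_small r s k : (k < s)%N -> builds r s k (fun=> 1).
Proof.
move=> ks; exists 1, 1, (k + r)%N; split=> // n nk; exists 1%N, (fun _ _ => set0).
rewrite mulr1; split=> //.
have rn : (r <= n)%N by lia.
rewrite -[X in X <= _](Ex_cst (Om_gt0 rn) 1).
apply: Ex_le => us _ _; rewrite ler1n lt0b; apply/cliqueP.
exists (pre k setT); first by rewrite card_pre cardsT card_ord; lia.
by move=> e /subset_leq_card; rewrite card_pre => ek es; move: ek; rewrite es; lia.
Qed.

(* root h e n stands for n^(h/e), so that rate r h e n is n^(r - h/e). *)
Variable root : nat -> nat -> nat -> R.
Hypothesis root_gt0 : forall h e n, (0 < n)%N -> 0 < root h e n.
Hypothesis rootX : forall h e n, (0 < e)%N -> (0 < n)%N -> root h e n ^+ e = n%:R ^+ h.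

Definition rate r h e n : R := n%:R ^+ r / root h e n.

Lemma root_le_expn h e n a : (0 < n)%N -> (0 < e)%N -> (h <= a * e)%N ->
  root h e n <= n%:R ^+ a.
Proof.
move=> n0 e0 he; rewrite -(ler_pXn2r e0) ?nnegrE ?exprn_ge0 ?(ltW (root_gt0 _ _ _)) //.
by rewrite rootX // -exprM ler_weXn2l // ler1n.
Qed.

Lemma rate_ge r h e n a : (0 < n)%N -> (0 < e)%N -> (a <= r)%N -> (h <= (r - a) * e)%N ->
  n%:R ^+ a <= rate r h e n.
Proof.
move=> n0 e0 ar he; rewrite /rate ler_pdivlMr ?root_gt0 //.
rewrite -[in X in _ <= X](subnKC ar) exprD ler_wpM2l ?exprn_ge0 //.
by rewrite root_le_expn.
Qed.

Lemma rate_le r h e h' e' n : (0 < n)%N -> (0 < e)%N -> (0 < e')%N ->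
  (h' * e <= h * e')%N -> rate r h e n <= rate r h' e' n.
Proof.
move=> n0 e0 e'0 he; rewrite /rate ler_wpM2l ?exprn_ge0 // lef_pV2 ?posrE ?root_gt0 //.
have ee0 : (0 < e * e')%N by rewrite muln_gt0 e0.
rewrite -(ler_pXn2r ee0) ?nnegrE ?(ltW (root_gt0 _ _ _)) //.
by rewrite [X in _ <= X]exprM [(e * e')%N]mulnC exprM !rootX // -!exprM ler_weXn2l ?ler1n.
Qed.

Section Step.
Variables (r s l h : nat).
Hypothesis r2 : (2 <= r)%N.
Hypothesis rs : (r <= s)%N.
Hypothesis rh : (r <= h)%N.
Local Notation e := (nedges s l s h).
Local Notation e0 := (nedges s l r).
Hypothesis e_gt0 : (0 < e)%N.
Hypothesis ext : ((h - r) * e <= h * (e0 h - e0 r))%N.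
Local Notation Y := (rate r h e).

(** For [r < h], the condition [ext] forces [e0 h] to be positive. The resulting [h <= e] and
    [2 <= r] make the rate at least [n], so it tends to infinity. *)
Lemma leq_parts_nedges : (r < h)%N -> (h <= e)%N.
Proof.
move=> rh'; apply: leq_trans (leq_nedgesc s l h rs); apply: nedges_gt0_geq => //.
have : (0 < (h - r) * e)%N by rewrite muln_gt0 subn_gt0 rh'.
by move/leq_trans => /(_ _ ext); rewrite muln_gt0 subn_gt0 => /andP[_]; apply: leq_ltn_trans.
Qed.

Lemma rate_ge1 n : (0 < n)%N -> 1 <= Y n.
Proof.
move=> n0; rewrite -[X in X <= _](expr0 n%:R) rate_ge // subn0.
have [rE|hr] := eqVneq r h; first by rewrite rE leq_pmulr.
apply: leq_trans (leq_parts_nedges _) _; first by rewrite ltn_neqAle hr.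
by apply: leq_pmull; lia.
Qed.

Lemma rate_gen n : (r < h)%N -> (0 < n)%N -> n%:R <= Y n.
Proof.
move=> rh' n0; rewrite -[X in X <= _]expr1 rate_ge //; first by lia.
by apply: leq_trans (leq_parts_nedges rh') _; apply: leq_pmull; lia.
Qed.

Lemma stage_rate : exists (C delta : R) (N : nat), [/\ 0 < C, 0 < delta &
  forall n, (N <= n)%N -> exists2 m : nat, m%:R <= C * Y n &
    forall L : {set 'I_n}, #|L| = l -> exists g,
      delta <= Ex [set U : {set 'I_n} | #|U| == r] (e * m)
       (fun us => (extends s L (l + h) (run r s g [::] us))%:R)].
Proof.
pose K := (2 ^ r * r`!)%N.
have K1 : 1 <= K%:R :> R by rewrite ler1n muln_gt0 expn_gt0 fact_gt0.
have h0 : (0 < h)%N by lia.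
have [c [al [eta [N [[c0 c1 al0] [alc et0 be0] etc HN]]]]] :
  exists (c al eta : R) (N : nat), [/\ [/\ 0 < c, c <= 1 & 0 < al],
    [/\ al * (1 + 2 * c * K%:R) <= 1, 0 <= eta & 0 < al ^+ e - (2 ^ h)%:R * eta],
    (r < h)%N -> 2 * c * K%:R <= eta /\ eta <= 1 &
    forall n, (N <= n)%N -> 1 <= c * Y n].
  (* If [h = r], distinct copies never share [r] vertices, so nothing is lost to isolation:
     [eta = 0] and [c = 1] work. *)
  have [hr|hr] := eqVneq h r.
    exists 1, (1 + 2 * K%:R)^-1, 0, 1%N; rewrite [X in (_ < X)%N]hr ltnn; split=> //.
    - by split=> //; rewrite invr_gt0; lra.
    - split=> //; first by rewrite mulr1 mulVf // gt_eqF //; lra.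
      by rewrite mulr0 subr0 exprn_gt0 // invr_gt0; lra.
    - by move=> n n0; rewrite mul1r rate_ge1.
  have rh' : (r < h)%N by rewrite ltn_neqAle eq_sym hr.
  (* With [al = 1/2], this makes [2 ^ h * eta] half of [al ^+ e]. Then [c = eta / (2K)] turns
     [2 c K] into [eta], and [N] is taken so that [c * Y n >= 1]. *)
  pose eta : R := ((2 ^ h)%:R * 2 ^+ e.+1)^-1.
  have p2 : 1 <= (2 ^ h)%:R :> R by rewrite ler1n expn_gt0.
  have p3 : 1 <= 2 ^+ e.+1 :> R by rewrite exprn_ege1 // ler1n.
  have et0 : 0 < eta by rewrite invr_gt0 mulr_gt0 // (lt_le_trans ltr01).
  have et1 : eta <= 1 by rewrite invf_le1 ?mulr_ege1 // mulr_gt0 // (lt_le_trans ltr01).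
  have c0 : 0 < eta / (2 * K%:R) by rewrite divr_gt0 // mulr_gt0 // (lt_le_trans ltr01).
  have c1 : eta / (2 * K%:R) <= 1 by rewrite ler_pdivrMr; lra.
  have cE : 2 * (eta / (2 * K%:R)) * K%:R = eta by field; rewrite gt_eqF // (lt_le_trans ltr01).
  exists (eta / (2 * K%:R)), 2^-1, eta, (Num.truncn (eta / (2 * K%:R))^-1).+1.
  split=> //; rewrite ?cE.
  - by split=> //; lra.
  - split=> //; [lra|exact: ltW|].
    have -> : (2 ^ h)%:R * eta = 2^-1 ^+ e.+1 :> R.
      by rewrite /eta exprVn invfM mulVKf // gt_eqF // (lt_le_trans ltr01).
    have : 0 < (2^-1 : R) ^+ e by rewrite exprn_gt0 // invr_gt0.
    by rewrite subr_gt0 exprS; lra.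
  - by [].
  - move=> n nN; have n0 : (0 < n)%N by apply: leq_trans nN.
    rewrite mulrC -ler_pdivrMr // mul1r; apply: le_trans (rate_gen rh' n0).
    apply: ltW; apply: lt_le_trans (_ : (Num.truncn (eta / (2 * K%:R))^-1).+1%:R <= _).
      by rewrite truncnS_gt.
    by rewrite ler_nat.
exists (2 * c), (stage_delta r s l h c al eta), (N + 2 * l + 4 * h + 2 * r)%N; split.
- by rewrite mulr_gt0.
- rewrite /stage_delta divr_gt0 ?mulr_gt0 ?invr_gt0 ?exprn_gt0 //.
    by rewrite ltr0n muln_gt0.
  by rewrite ltr_pwDl // mulr_ge0 // exprn_ge0.
move=> n nN; have n0 : (0 < n)%N by lia.
have cY := HN n ltac:(lia).
(* Rounding up at most doubles the value because [c * Y n >= 1]. *)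
pose m := (Num.truncn (c * Y n)).+1.
have mlo : c * Y n <= m%:R by rewrite ltW // truncnS_gt.
have mhi : m%:R <= 2 * c * Y n.
  rewrite /m -natr1; have : (Num.truncn (c * Y n))%:R <= c * Y n.
    by rewrite truncn_le //; lra.
  lra.
exists m => // L Ll.
have r0 : (0 < r)%N by lia.
by apply: (@stage_success R r s l h r0 rs rh e_gt0 ext c al eta (root h e n) n) => //;
  rewrite ?rootX ?root_gt0 //; lia.
Qed.

Lemma builds_step (Y' : nat -> R) :
  builds r s l Y' -> (forall n, (0 < n)%N -> Y' n <= Y n) -> builds r s (l + h) Y.
Proof.
move=> [C1 [d1 [N1 [C10 d10 H1]]]] YY; have [C2 [d2 [N2 [C20 d20 H2]]]] := stage_rate.
exists (C1 + e%:R * C2), (d2 * d1), (N1 + N2 + r)%N; split.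
- by rewrite ltr_pwDl // mulr_ge0 // ltW.
- by rewrite mulr_gt0.
move=> n nN; have n0 : (0 < n)%N by lia.
have [B [g [B0 BC Bd]]] := H1 n ltac:(lia).
have [m mC Hm] := H2 n ltac:(lia).
(* One player is chosen for each of the finitely many sets [L]; sets of the wrong size receive [g]
   as a dummy. *)
have [G HG] : exists G : {set 'I_n} -> seq {set 'I_n} -> {set 'I_n} -> {set 'I_n},
    forall L : {set 'I_n}, #|L| = l -> d2 <= Ex [set U : {set 'I_n} | #|U| == r] (e * m)
       (fun us => (extends s L (l + h) (run r s (G L) [::] us))%:R).
  apply: (fin_all_exists (P := fun (L : {set 'I_n}) g => #|L| = l ->
     d2 <= Ex [set U : {set 'I_n} | #|U| == r] (e * m) (fun us => (extends s L (l + h) (run r s g [::] us))%:R))) => L.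
  have [Ll|nL] := eqVneq #|L| l; first by have [g0 ?] := Hm L Ll; exists g0.
  by exists g => Ll; rewrite Ll eqxx in nL.
exists (B + e * m)%N, (sequel r s l B g G); split; first by rewrite addn_gt0 B0.
  rewrite natrD natrM mulrDl lerD //.
    by apply: le_trans BC _; rewrite ler_wpM2l ?(ltW C10) // YY.
  by rewrite -mulrA ler_wpM2l.
by apply: Ex_sequel => //; [exact: ltW | lia].
Qed.

End Step.
Lemma ltn_bin s l k : (0 < s)%N -> (s <= k)%N -> (l < k)%N -> ('C(l, s) < 'C(k, s))%N.
Proof.
case: s => // s _; case: k => // k sk lk; rewrite binS -addn1 leq_add ?leq_bin2l //.
by rewrite bin_gt0.
Qed.

(** Strong induction on [k]: first build a clique on [l] vertices, then extend it by [k - l]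
    vertices. *)
Lemma builds_clique r s : (2 <= r)%N -> (r < s)%N -> forall k l,
  (l + r <= k)%N -> (s <= k)%N ->
  ((k - l - r) * nedges s l s (k - l)
    <= (k - l) * (nedges s l r (k - l) - nedges s l r r))%N ->
  builds r s k (rate r (k - l) (nedges s l s (k - l))).
Proof.
move=> r2 rs; elim/ltn_ind => k IH l lrk sk ext.
have eE a b : (a <= b)%N -> nedges s a s (b - a) = ('C(b, s) - 'C(a, s))%N.
  by move=> ab; have := nedges_all s a (b - a); rewrite subnKC // => <-; rewrite addnK.
have e0 a b : (a < b)%N -> (s <= b)%N -> (0 < nedges s a s (b - a))%N.
  by move=> ab sb; rewrite eE ?(ltnW ab) // subn_gt0 ltn_bin //; lia.
have lk : (l < k)%N by lia.
have rh : (r <= k - l)%N by lia.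
have eg := e0 l k lk sk.
rewrite -{1}(subnKC (ltnW lk)).
have [ls|sl] := ltnP l s.
  apply: (builds_step r2 (ltnW rs) rh eg ext (builds_small r ls)) => n n0.
  exact: (rate_ge1 r2 (ltnW rs) rh eg ext n0).
(* The base clique is itself built by adding [r] vertices to [l - r]: then the extension condition
   has left side 0. Its rate does not exceed the present one by [bin_density]. *)
have lr : (l - (l - r) = r)%N by lia.
have := IH l lk (l - r)%N; rewrite lr subnn mul0n => /(_ _ sl isT) H.
apply: (builds_step r2 (ltnW rs) rh eg ext (H _)) => [|n n0]; first by lia.
have e1 := e0 (l - r)%N l ltac:(lia) sl; rewrite lr in e1.
have E1 := eE (l - r)%N l (leq_subr _ _); rewrite lr in E1.
apply: rate_le => //; rewrite E1 eE ?(ltnW lk) // -{2}lr.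
by apply: bin_density; rewrite ?leq_subr ?(ltnW lk) //; lia.
Qed.

End Rates.

(** * The strategy *)

Section Strategy.
Variables (r s : nat) (g : forall n, seq {set 'I_n} -> {set 'I_n} -> {set 'I_n}).

(** Discards the answers recorded in the history and keeps the draws. *)
Definition strategy_of : strategy :=
  fun n hist u => legal r s u (g [seq p.1 | p <- hist] u).

Lemma edges_strategy_of n (us : seq {set 'I_n}) :
  edges_of strategy_of us = run r s (@g n) [::] us.
Proof.
have H hist : [seq p.1 :|: p.2 | p <- play_aux (@strategy_of n) hist us] =
    [seq p.1 :|: p.2 | p <- hist] ++ run r s (@g n) [seq p.1 | p <- hist] us.
  elim: us hist => [|u us IH] hist /=; first by rewrite cats0.
  by rewrite IH !map_rcons cat_rcons.
exact: H.
Qed.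

Lemma prob_cliqueE k n t : r <= n ->
  prob_clique r s k strategy_of n t =
  Ex [set U : {set 'I_n} | #|U| == r] t
    (fun us => ((contains_clique k s (run r s (@g n) [::] us))%:R)%R) :> R.
Proof.
move=> rn; rewrite /prob_clique RdivE !INRE.
set Om := [set U : {set 'I_n} | _]; have Om0 : 0 < #|Om| := Om_gt0 rn.
have aO (us : seq {set 'I_n}) : all (fun U : {set 'I_n} => #|U| == r) us = all (mem Om) us.
  by apply: eq_all => U; rewrite /= inE.
set p := Ex _ _ _.
rewrite [X in (X / _)%R](_ : _ = #|Om|%:R ^+ t * p)%R; last first.
  rewrite -(card_Ex R Om0); congr (_%:R)%R; apply: eq_card => w.
  by rewrite !inE aO edges_strategy_of.
rewrite [X in (_ / X)%R](_ : _ = #|Om|%:R ^+ t)%R; last first.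
  rewrite -[RHS]mulr1 -[X in (_ * X)%R](Ex_cst Om0 t) -(card_Ex R Om0 t predT).
  by congr (_%:R)%R; apply: eq_card => w; rewrite !inE aO andbT.
rewrite mulrAC mulfV ?mul1r //.
by rewrite expf_neq0 // pnatr_eq0 -lt0n.
Qed.

End Strategy.

(** * Rates as real powers of n *)

Section RealRates.
Local Open Scope ring_scope.

Definition real_root (h e n : nat) : R := Rpower (INR n) (Rdiv (INR h) (INR e)).

Lemma real_root_gt0 h e n : (0 < n)%N -> 0 < real_root h e n.
Proof. by move=> _; apply/RltP; exact: exp_pos. Qed.

Lemma real_rootX h e n : (0 < e)%N -> (0 < n)%N -> real_root h e n ^+ e = n%:R ^+ h.
Proof.
move=> e0 n0; have nR : Rlt R0 (INR n) by apply: lt_0_INR; lia.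
rewrite -RpowE -Rpower_pow; last exact: exp_pos.
rewrite /real_root Rpower_mult /Rdiv Rmult_assoc Rinv_l.
  by rewrite Rmult_1_r Rpower_pow // RpowE INRE.
by apply: not_0_INR; lia.
Qed.

Lemma rate_expo k r s l n : (0 < n)%N -> (l <= k)%N -> ('C(l, s) <= 'C(k, s))%N ->
  rate real_root r (k - l) ('C(k, s) - 'C(l, s)) n = Rpower (INR n) (expo k r s l).
Proof.
move=> n0 lk Ck; have nR : Rlt R0 (INR n) by apply: lt_0_INR; lia.
rewrite /expo RminusE /Rminus Rpower_plus Rpower_pow // Rpower_Ropp RpowE /rate.
by rewrite -INRE /real_root !INRE !natrB.
Qed.

End RealRates.

(** * The condition on l in terms of edge counts *)

Section EllCondition.
Local Open Scope ring_scope.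

Lemma ell_condE k r s l : (0 < r)%N -> ell_cond k r s l <->
  ((k%:R - l%:R - r%:R - (k%:R - l%:R) / ('C(k, s)%:R - 'C(l, s)%:R) *
    ((nedges s l r (k - l))%:R - (nedges s l r r)%:R)) <= 0 :> R).
Proof.
move=> r0; rewrite /ell_cond.
set S := sum_f _ _ _; have -> : S = (nedges s l r (k - l))%:R - (nedges s l r r)%:R.
  rewrite /S /sum_f sum_f_R0E /nedges !big_add1 !natr_sum -sumrB.
  have -> : (Nat.sub r 1).+1 = r by lia.
  apply: eq_big_nat => j _; rewrite !INRE /= !natrM -mulrBr.
  by have -> : Nat.add j 1 = j.+1 by lia.
rewrite !INRE; split; first by move=> /RleP.
by move=> H; apply/RleP.
Qed.

(** At [k - r] the two binomials in each bracket coincide and [k - l - r] vanishes. So the smallest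
    solution satisfies [l + r <= k]. *)
Lemma ell_cond_max k r s : (0 < r)%N -> (r <= k)%N -> ell_cond k r s (k - r).
Proof.
move=> r0 rk; apply/(ell_condE _ _ _ r0); rewrite subKn // subrr mulr0 subr0.
by rewrite natrB //; lra.
Qed.

Lemma ell_cond_nat k r s l : (0 < r)%N -> (r <= s)%N -> (s <= k)%N -> (l + r <= k)%N ->
  ell_cond k r s l ->
  ((k - l - r) * nedges s l s (k - l)
    <= (k - l) * (nedges s l r (k - l) - nedges s l r r))%N.
Proof.
move=> r0 rs sk lrk /(ell_condE _ _ _ r0); rewrite -natrB; last by lia.
have rh : (r <= k - l)%N by lia.
have lk : (l < k)%N by lia.
have CC : ('C(l, s) < 'C(k, s))%N by apply: ltn_bin => //; lia.
have eE : nedges s l s (k - l) = ('C(k, s) - 'C(l, s))%N.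
  by have := nedges_all s l (k - l); rewrite subnKC ?(ltnW lk) // => <-; rewrite addnK.
rewrite -(natrB _ rh) -(natrB _ (ltnW CC)) -(natrB _ (leq_nedges s l r rh)) -eE.
rewrite subr_le0 mulrAC ler_pdivlMr; last by rewrite ltr0n eE subn_gt0.
by rewrite -!natrM ler_nat.
Qed.

End EllCondition.

Theorem theorem7 (r s k l : nat) :
  2 <= r -> r < s -> s <= k ->
  ell_cond k r s l -> (forall l' : nat, l' < l -> ~ ell_cond k r s l') ->
  exists S : strategy, valid_strategy r s S /\
    forall t : nat -> nat,
      much_larger (fun n => INR (t n)) (fun n => Rpower (INR n) (expo k r s l)) ->
      Un_cv (fun n => prob_clique r s k S n (t n)) R1.
Proof.
move=> r2 rs sk cond minl.
have lrk : l + r <= k.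
  rewrite leqNgt; apply/negP => kl; apply: (minl (k - r)); first by lia.
  by apply: ell_cond_max; lia.
have ext := ell_cond_nat (ltnW r2) (ltnW rs) sk lrk cond.
have CC : 'C(l, s) < 'C(k, s) by apply: ltn_bin => //; lia.
have eE : nedges s l s (k - l) = 'C(k, s) - 'C(l, s).
  by have := nedges_all s l (k - l); rewrite subnKC; [move=> <-; rewrite addnK | lia].
have [C [d [N [C0 d0 HN]]]] :=
  builds_clique real_root_gt0 real_rootX r2 rs lrk sk ext.
rewrite eE in HN.
(* For [n < N] the predicate is vacuous, so a block and a player can be chosen for every [n]. *)
pose P n (Bg : nat * (seq {set 'I_n} -> {set 'I_n} -> {set 'I_n})) := N <= n ->
  [/\ 0 < Bg.1, (Bg.1%:R <= C * rate real_root r (k - l) ('C(k, s) - 'C(l, s)) n)%R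
    & (d <= Ex [set U : {set 'I_n} | #|U| == r] Bg.1
      (fun us => (contains_clique k s (run r s Bg.2 [::] us))%:R))%R].
have exP n : exists Bg, P n Bg.
  have [Nn|nN] := leqP N n; last by exists (0, fun _ _ => set0) => Nn; lia.
  by have [B [g H]] := HN n Nn; exists (B, g).
pose Bg n := proj1_sig (constructive_indefinite_description _ (exP n)).
have BgP n : P n (Bg n) by apply: proj2_sig.
(* The block is replayed forever, so the strategy depends neither on [t] nor on [eps]. *)
exists (strategy_of r s (fun n => restart (Bg n).1 (Bg n).2)); split.
  by move=> n sn hist U; apply: legalP => //; exact: ltnW.
move=> t tbig eps eps0.
have d1 : (d <= 1)%R.
  have [_ _] := BgP (N + r) (leq_addr _ _); move/le_trans; apply.
  have rn : r <= N + r by rewrite leq_addl.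
  rewrite -[leRHS](Ex_cst (Om_gt0 rn) (Bg (N + r)).1); apply: Ex_le => us _ _.
  by case: (contains_clique _ _ _).
(* Enough blocks to bring the probability that all of them fail below [eps]. *)
have [b Hb] : exists b, ((1 - d) ^+ b < eps)%R.
  have d1' : Rlt (Rabs (1 - d)%R) 1 by apply/RltP; rewrite RabsE R1E ger0_norm; lra.
  have [b Hb] := pow_lt_1_zero _ d1' eps eps0.
  exists b; have /RltP := Hb b (Nat.le_refl b); rewrite RabsE RpowE ger0_norm // exprn_ge0 //.
  by rewrite subr_ge0.
(* Eventually [t n >= D * Y], which leaves room for [b] blocks of at most [C * Y] draws; the added 1
   keeps [D] positive. *)
pose D : R := (b%:R * C + 1)%R.
have D0 : (0 < D)%R by rewrite ltr_wpDl // mulr_ge0 // ltW.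
have D'0 : Rlt R0 (D^-1)%R by apply/RltP; rewrite invr_gt0.
have [N2 HN2] := tbig _ D'0.
exists (N + N2 + r + 1) => n /ssrnat.leP nN.
have n0 : 0 < n by lia.
have rn : r <= n by lia.
have [B0 BC Bd] := BgP n ltac:(lia).
have bt : b * (Bg n).1 <= t n.
  have := HN2 n ltac:(lia).
  move/RleP; rewrite !RabsE RmultE [INR (t n)]INRE normr_nat -rate_expo //; [|lia|exact: ltnW].
  set Y := rate _ _ _ _ _ in BC *; move=> H.
  have Y0 : (0 <= Y)%R by rewrite divr_ge0 ?exprn_ge0 // ltW // real_root_gt0.
  rewrite ger0_norm // mulrC ler_pdivlMr // in H.
  rewrite -(ler_nat R) natrM; apply: le_trans H.
  apply: le_trans (ler_wpM2l (ler0n _ b) BC) _.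
  by rewrite [leRHS](_ : _ = b%:R * (C * Y) + Y)%R; [rewrite lerDl | rewrite /D; ring].
have := Ex_restart rn B0 bt Bd d1.
rewrite /R_dist prob_cliqueE //; set p := Ex _ _ _ => Hp.
have p1 : (p <= 1)%R.
  rewrite -[leRHS](Ex_cst (Om_gt0 rn) (t n)); apply: Ex_le => us _ _.
  by case: (contains_clique _ _ _).
apply/RltP; rewrite RabsE RminusE -[R1]/(1%R : R) distrC ger0_norm ?subr_ge0 //.
by move: Hb Hp; lra.
Qed.
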